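(* Let $k\ge 1$ and $m_1,\dots,m_k\ge 3$, and let $\bigvee_{i=1}^k C_{m_i}$ be the wedge of the cycle graphs $C_{m_1},\dots,C_{m_k}$ obtained by identifying one vertex from each cycle into a single common vertex. Then the independence complex $\mathcal{I}\big(\bigvee_{i=1}^k C_{m_i}\big)$ is either contractible or homotopy equivalent to a wedge of spheres.
   Context: The cycle graph $C_n$ has vertices $1,\dots,n$ with edges $\{i,i+1\}$ (indices mod $n$). The wedge of finitely many graphs $G_i=(V_i,E_i)$ at chosen vertices $a_i\in V_i$ has vertex set $\bigcup_i(V_i\setminus\{a_i\})\cup\{a\}$, with all edges of the $G_i$ not incident to $a_i$ together with edges $ab$ for each edge $a_ib$ of $G_i$. The independence complex $\mathcal{I}(G)$ is the simplicial complex whose simplices are the independent vertex sets of $G$. *)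

(* Defs.v *)
From HB Require Import structures.
From mathcomp Require Import all_boot all_order all_algebra.
From mathcomp Require Import all_classical all_reals all_analysis.
From mathcomp Require Import homotopy.

Set Implicit Arguments.
Unset Strict Implicit.
Unset Printing Implicit Defensive.

Import Order.TTheory GRing.Theory Num.Theory.
Import numFieldNormedType.Exports.

Local Open Scope classical_set_scope.
Local Open Scope ring_scope.

(** Finite graphs are represented by their adjacency relation on a [finType]. *)

(** The vertices [1, ..., n] are numbered [0, ..., n - 1]; [ordS i] is [i + 1]
    mod [n]. This is a simple graph only for [n >= 2], see [cycle_adj_irr]. *)
Definition cycle_adj (n : nat) : rel 'I_n :=
  fun i j => (j == ordS i) || (i == ordS j).

Lemma cycle_adj_sym (n : nat) : symmetric (@cycle_adj n).
Proof. by move=> i j; rewrite /cycle_adj orbC. Qed.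

Lemma cycle_adj_irr (n : nat) : (1 < n)%N -> irreflexive (@cycle_adj n).
Proof.
move=> n1 i; rewrite /cycle_adj orbb; apply/negbTE/eqP => /(congr1 val) /=.
have := ltn_ord i; rewrite leq_eqVlt => /orP[/eqP i1n|i1n].
  by rewrite i1n modnn => i0; rewrite -i1n i0 in n1.
by rewrite modn_small // => /n_Sn.
Qed.

(** [None] is the common vertex, and [Some (i; x)] is a vertex [x != a i] of the
    [i]-th graph. *)
Definition graph_wedge (I : finType) (V : I -> finType) (a : forall i, V i) :
    finType :=
  option {i : I & {x : V i | x != a i}}.

Definition graph_wedge_adj (I : finType) (V : I -> finType)
    (e : forall i, rel (V i)) (a : forall i, V i) : rel (graph_wedge a) :=
  fun u v => match u, v with
  | None, None => false
  | None, Some q => e (tag q) (a (tag q)) (val (tagged q))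
  | Some p, None => e (tag p) (val (tagged p)) (a (tag p))
  | Some p, Some q =>
      (tag p == tag q) && e (tag p) (val (tagged p)) (val (tagged_as p q))
  end.
Arguments graph_wedge_adj {I V} e a.

Lemma graph_wedge_adj_sym (I : finType) (V : I -> finType)
    (e : forall i, rel (V i)) (a : forall i, V i) :
  (forall i, symmetric (e i)) -> symmetric (graph_wedge_adj e a).
Proof.
move=> es [[i x]|] [[j y]|] //=; last 2 first.
- exact: es.
- exact: es.
have [ij|] //= := eqVneq i j; subst j.
by rewrite !tagged_asE; exact: es.
Qed.

Lemma graph_wedge_adj_irr (I : finType) (V : I -> finType)
    (e : forall i, rel (V i)) (a : forall i, V i) :
  (forall i, irreflexive (e i)) -> irreflexive (graph_wedge_adj e a).
Proof. by move=> ei [[i x]|] //=; rewrite tagged_asE eqxx ei. Qed.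

(** A finite simplicial complex on [V] is given by its set of simplices; the
    empty simplex is included, and contributes no point to the realization. *)
Definition independence_complex (V : finType) (e : rel V) : {set {set V}} :=
  finset (fun A : {set V} => [forall x in A, forall y in A, ~~ e x y]).

(** Points of the realization are given by barycentric coordinates; the topology
    is the one induced by the product [R ^ V]. *)
Definition realization_set (R : realType) (V : finType) (K : {set {set V}}) :
    set (prod_topology (fun _ : V => R)) :=
  [set t : V -> R | [/\ forall v, 0 <= t v,
               \sum_v t v = 1
             & finset (fun v => t v != 0) \in K]].

Definition realization (R : realType) (V : finType) (K : {set {set V}}) :
    topologicalType :=
  set_type (@realization_set R V K).

Definition sphere (R : realType) (n : nat) : set 'rV[R]_n.+1 :=
  [set x : 'rV[R]_n.+1 | \sum_i x ord0 i ^+ 2 = 1].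
Arguments sphere R n : clear implicits.

Definition homotopic (R : realType) (X Y : topologicalType) (f g : X -> Y) :
    Prop :=
  exists H : X * R -> Y,
    [/\ {within [set: X] `*` `[0, 1], continuous H},
        forall x, H (x, 0) = f x
      & forall x, H (x, 1) = g x].

Definition homotopy_equivalent (R : realType) (X Y : topologicalType) : Prop :=
  exists (f : X -> Y) (g : Y -> X),
    [/\ continuous f, continuous g,
        homotopic R (g \o f) idfun & homotopic R (f \o g) idfun].

Definition contractible (R : realType) (X : topologicalType) : Prop :=
  exists x0 : X, homotopic R idfun (fun _ : X => x0).

(** A nonempty finite wedge; the dimensions may differ, and may be [0]. *)
Definition equivalent_to_wedge_of_spheres (R : realType) (X : topologicalType) :
    Prop :=
  exists (r : nat) (d : 'I_r.+1 -> nat) (p : forall i, sphere R (d i)),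
    homotopy_equivalent R X (wedge p).

(* Main.v *)
Require Import Defs.
From mathcomp Require Import all_boot all_order all_algebra.
From mathcomp Require Import all_classical all_reals all_analysis.
From mathcomp Require Import homotopy zify.

(** Two moves keep the homotopy type of an independence complex: deleting [v]
    when [N(u)] is contained in [N(v)], and adding or removing an edge [uv] when
    some [w] has [N(w)] contained in the union of [N(u)] and [N(v)].  Both are
    straight-line homotopies in barycentric coordinates.  With them three edges
    of a cycle of the wedge can be contracted at the cost of a disjoint edge, so
    the cycles may be assumed to have length 2 (a pendant edge), 3 or 4.

    If a square is present, the common vertex folds away; there remain an
    isolated vertex, and the complex is contractible, or disjoint edges, and the
    complex is the boundary of a cross-polytope.  If there is no square but a
    pendant edge, the neighbours of the common vertex fold onto its end, and
    again disjoint edges remain.  If all cycles are triangles, the complex is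
    the union of two boundaries of cross-polytopes whose intersection is a
    cone; contracting the cone turns the union into a wedge of two spheres. *)

Set Implicit Arguments.
Unset Strict Implicit.
Unset Printing Implicit Defensive.

Import Order.TTheory GRing.Theory Num.Theory.
Import numFieldNormedType.Exports.

Local Open Scope classical_set_scope.
Local Open Scope ring_scope.

(** * Homotopies *)

Section homotopy_relation.
Context {R : realType}.
Implicit Types X Y Z : topologicalType.

(** Contracting three edges at the cost of a disjoint edge reflects the suspension relation between
    the complexes of [C_n] and [C_(n-3)]: a single edge has two points as its complex, and adding a
    disjoint edge joins the complex with this 0-sphere. Joins and suspensions are never formed,
    however. The split-off edges stay in the graph, and only the final perfect matching is turned
    into a sphere, in one stroke, by radial rescaling between a cross-polytope and the round sphere.
    Every contracted path starts at the common vertex, so each cycle is shortened without touching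
    the others. A contraction uses five distinct vertices, hence stops at lengths 2, 3 and 4. The
    delicate case is that of triangles, where the two spheres share a cone instead of a point. No
    quotient is taken. An explicit homotopy preserves both spheres, fixes the apex and finally sends
    the whole cone to it; this alone suffices to compare a union of closed pieces with the wedge of
    the pieces. *)

Definition clamp (s : R) : R := Num.max 0 (Num.min 1 s).

Lemma clamp_ge0 s : 0 <= clamp s.
Proof. by rewrite /clamp le_max lexx. Qed.

Lemma clamp_le1 s : clamp s <= 1.
Proof. by rewrite /clamp ge_max ler01 ge_min lexx. Qed.

Lemma clamp0 : clamp 0 = 0.
Proof. by rewrite /clamp (min_idPr ler01) maxxx. Qed.

Lemma clamp1 : clamp 1 = 1.
Proof. by rewrite /clamp minxx (max_idPr ler01). Qed.

Lemma clamp_continuous : continuous clamp.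
Proof.
move=> s; apply: continuous_max; first exact: cvg_cst.
by apply: continuous_min; [exact: cvg_cst|exact: cvg_id].
Qed.

Lemma comp_continuous X Y Z (f : X -> Y) (g : Y -> Z) :
  continuous f -> continuous g -> continuous (g \o f).
Proof. by move=> cf cg x; apply: continuous_comp; [exact: cf|exact: cg]. Qed.

Lemma pair_continuous X Y Z (f : X -> Y) (g : X -> Z) :
  continuous f -> continuous g -> continuous (fun x => (f x, g x)).
Proof.
move=> cf cg x U [[A B] /= [/cf fA /cg gB] AB]; rewrite nbhs_simpl /=.
move: fA gB; rewrite !nbhs_simpl /= => fA gB.
by apply: filterS2 fA gB => z Az Bz; exact: AB.
Qed.

Lemma fst_continuous X Y : continuous (@fst X Y).
Proof. by move=> z; exact: cvg_fst. Qed.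

Lemma snd_continuous X Y : continuous (@snd X Y).
Proof. by move=> z; exact: cvg_snd. Qed.

Lemma add_fun_continuous X (f g : X -> R) :
  continuous f -> continuous g -> continuous (fun x => f x + g x).
Proof. by move=> cf cg x; apply: cvgD; [exact: cf|exact: cg]. Qed.

Lemma sub_fun_continuous X (f g : X -> R) :
  continuous f -> continuous g -> continuous (fun x => f x - g x).
Proof. by move=> cf cg x; apply: cvgB; [exact: cf|exact: cg]. Qed.

Lemma mul_fun_continuous X (f g : X -> R) :
  continuous f -> continuous g -> continuous (fun x => f x * g x).
Proof. by move=> cf cg x; apply: cvgM; [exact: cf|exact: cg]. Qed.

Lemma min_fun_continuous X (f g : X -> R) :
  continuous f -> continuous g -> continuous (fun x => Num.min (f x) (g x)).
Proof. by move=> cf cg x; apply: continuous_min; [exact: cf|exact: cg]. Qed.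

Lemma max_fun_continuous X (f g : X -> R) :
  continuous f -> continuous g -> continuous (fun x => Num.max (f x) (g x)).
Proof. by move=> cf cg x; apply: continuous_max; [exact: cf|exact: cg]. Qed.

Lemma cst_fun_continuous X Y (y : Y) : continuous (fun _ : X => y).
Proof. by move=> x; exact: cvg_cst. Qed.

(** Precomposing with [clamp] extends a homotopy from the unit interval to all of [R], so that later
    proofs deal with plain continuity instead of continuity within a subset. *)
Lemma homotopicP X Y (f g : X -> Y) :
  homotopic R f g <-> exists H : X * R -> Y,
    [/\ continuous H, forall x, H (x, 0) = f x & forall x, H (x, 1) = g x].
Proof.
split=> [[H [cH H0 H1]]|[H [cH H0 H1]]]; last first.
  by exists H; split => //; exact: continuous_subspaceT.
exists (fun z => H (z.1, clamp z.2)); split=> [z|x|x] /=; last 2 first.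
- by rewrite clamp0.
- by rewrite clamp1.
pose c (z : X * R) := (z.1, clamp z.2).
have Ac z' : ([set: X] `*` `[0, 1]) (c z').
  by split => //=; rewrite in_itv /= clamp_ge0 clamp_le1.
have cc : continuous c.
  apply: pair_continuous; first exact: fst_continuous.
  exact: (comp_continuous (@snd_continuous X R) clamp_continuous).
move/subspace_continuousP: cH => /(_ (c z) (Ac z)) cH.
apply: cvg_comp cH => U; rewrite /= /within /= => /cc.
by rewrite nbhs_simpl /=; apply: filterS => z' /(_ (Ac z')).
Qed.

Lemma homotopic_refl X Y (f : X -> Y) : continuous f -> homotopic R f f.
Proof.
move=> cf; apply/homotopicP; exists (f \o fst); split=> //.
by apply: comp_continuous cf; exact: fst_continuous.
Qed.

Lemma homotopic_sym X Y (f g : X -> Y) : homotopic R f g -> homotopic R g f.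
Proof.
move=> /homotopicP[H [cH H0 H1]]; apply/homotopicP.
exists (fun z => H (z.1, 1 - z.2)); split=> [|x|x] /=; last 2 first.
- by rewrite subr0.
- by rewrite subrr.
apply: comp_continuous cH.
apply: pair_continuous; first exact: fst_continuous.
by move=> z; apply: cvgB; [exact: cvg_cst|exact: cvg_snd].
Qed.

(** The pasting lemma. Near [x], a piece through [x] is handled by continuity within it, and any
    other piece is avoided because its complement is open; finiteness allows intersecting these
    neighbourhoods. *)
Lemma continuous_finite_closed_cover X Y (I : finType) (D : I -> set X)
    (f : X -> Y) :
  (forall i, closed (D i)) -> (forall x, exists i, D i x) ->
  (forall i, {within D i, continuous f}) -> continuous f.
Proof.
move=> cD Dx cf x U Uf; rewrite nbhs_simpl /=.
suff : \forall z \near x, forall i, D i z -> U (f z).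
  by apply: filterS => z; have [i Di] := Dx z => /(_ i Di).
apply: filter_forall => i.
have [Dix|nDix] := pselect (D i x).
  by move/subspace_continuousP: (cf i) => /(_ x Dix) /(_ U Uf); rewrite nbhs_simpl.
apply: (@filterS _ _ _ (~` D i)); first by move=> z nDz /nDz.
by apply: open_nbhs_nbhs; split => //; exact/closed_openC.
Qed.

Lemma homotopic_trans X Y (f g h : X -> Y) :
  homotopic R f g -> homotopic R g h -> homotopic R f h.
Proof.
move=> /homotopicP[H [cH H0 H1]] /homotopicP[K [cK K0 K1]]; apply/homotopicP.
pose H' (z : X * R) := H (z.1, 2 * z.2).
pose K' (z : X * R) := K (z.1, 2 * z.2 - 1).
have csc : continuous (fun z : X * R => 2 * z.2).
  by move=> z; apply: cvgM; [exact: cvg_cst|exact: cvg_snd].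
have cH' : continuous H'.
  apply: comp_continuous cH.
  by apply: pair_continuous; [exact: fst_continuous|exact: csc].
have cK' : continuous K'.
  apply: comp_continuous cK.
  apply: pair_continuous; first exact: fst_continuous.
  by move=> z; apply: cvgB; [exact: csc|exact: cvg_cst].
have lt21 : (1 / 2 < 1 :> R) by rewrite ltr_pdivrMr // mul1r ltr1n.
pose HK z := if z.2 <= 1 / 2 then H' z else K' z.
exists HK; rewrite /HK; split=> [|x|x] /=; last 2 first.
- by rewrite divr_ge0 // /H' /= mulr0.
- by rewrite leNgt lt21 /= /K' /= mulr1 [2]mulr2n addrK.
pose D (b : bool) : set (X * R) :=
  if b then [set z | z.2 <= 1 / 2] else [set z | 1 / 2 <= z.2].
have csnd := @snd_continuous X R.
apply: (@continuous_finite_closed_cover _ _ bool D).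
- case; rewrite /D.
  + have := @preimage_closed _ _ snd _ (fun z _ => csnd z) (@closed_le R (1/2)); exact.
  + have := @preimage_closed _ _ snd _ (fun z _ => csnd z) (@closed_ge R (1/2)); exact.
- by move=> z; have [zle|/ltW zge] := leP z.2 (1 / 2); [exists true|exists false].
- case.
  + apply: (@subspace_eq_continuous _ _ _ H' HK); last exact: continuous_subspaceT.
    by move=> z; rewrite inE /D /HK /= => ->.
  + apply: (@subspace_eq_continuous _ _ _ K' HK); last exact: continuous_subspaceT.
    move=> z; rewrite inE /D /HK /= => zge.
    have [zle|//] := leP z.2 (1 / 2).
    have zE : z.2 = 1 / 2 by apply/eqP; rewrite eq_le zle.
    by rewrite /H' /K' zE mulrC divfK // subrr H1 K0.
Qed.

Lemma homotopic_compl X Y Z (h : Y -> Z) (f g : X -> Y) :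
  continuous h -> homotopic R f g -> homotopic R (h \o f) (h \o g).
Proof.
move=> ch /homotopicP[H [cH H0 H1]]; apply/homotopicP.
exists (h \o H); split=> [|x|x] /=; rewrite ?H0 ?H1 //.
exact: comp_continuous.
Qed.

Lemma homotopic_compr X Y Z (h : X -> Y) (f g : Y -> Z) :
  continuous h -> homotopic R f g -> homotopic R (f \o h) (g \o h).
Proof.
move=> ch /homotopicP[H [cH H0 H1]]; apply/homotopicP.
exists (fun z => H (h z.1, z.2)); split=> [|x|x] /=; rewrite ?H0 ?H1 //.
apply: comp_continuous cH.
apply: pair_continuous; last exact: snd_continuous.
by apply: comp_continuous ch; exact: fst_continuous.
Qed.

Lemma homotopy_equivalent_sym X Y :
  homotopy_equivalent R X Y -> homotopy_equivalent R Y X.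
Proof. by move=> [f [g [? ? ? ?]]]; exists g, f; split. Qed.

Lemma homotopy_equivalent_trans Y X Z :
  homotopy_equivalent R X Y -> homotopy_equivalent R Y Z ->
  homotopy_equivalent R X Z.
Proof.
move=> [f [g [cf cg gf fg]]] [f' [g' [cf' cg' gf' fg']]].
exists (f' \o f), (g \o g'); split; [exact: comp_continuous..| |].
- apply: homotopic_trans gf.
  have /(homotopic_compr cf) /(homotopic_compl cg) := gf'; exact.
- apply: homotopic_trans fg'.
  have /(homotopic_compr cg') /(homotopic_compl cf') := fg; exact.
Qed.

Lemma homotopy_equivalent_contractible X Y :
  homotopy_equivalent R X Y -> contractible R Y -> contractible R X.
Proof.
move=> [f [g [cf cg gf fg]]] [y0 cy]; exists (g y0).
apply: homotopic_trans (homotopic_sym gf) _.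
by have /(homotopic_compr cf) /(homotopic_compl cg) := cy.
Qed.

Lemma homotopy_equivalent_wedge_of_spheres X Y :
  homotopy_equivalent R X Y -> equivalent_to_wedge_of_spheres R Y ->
  equivalent_to_wedge_of_spheres R X.
Proof.
move=> XY [r [d [p Yp]]]; exists r, d, p; exact: homotopy_equivalent_trans Yp.
Qed.

End homotopy_relation.

(** * Realizations *)

Section realization.
Context {R : realType} {V : finType}.
Implicit Types (X : topologicalType) (K L : {set {set V}}).

Definition bary K (x : realization R K) (v : V) : R := (set_val x : V -> R) v.

Definition supp (t : V -> R) : {set V} := finset (fun v => t v != 0).

Lemma bary_ge0 K (x : realization R K) v : 0 <= bary x v.
Proof. by have [+ _ _] := set_valP x; apply. Qed.

Lemma bary_sum K (x : realization R K) : \sum_v bary x v = 1.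
Proof. by have [_ + _] := set_valP x. Qed.

Lemma bary_supp K (x : realization R K) : supp (bary x) \in K.
Proof. by have [_ _] := set_valP x. Qed.

Lemma bary_inj K (x y : realization R K) : bary x =1 bary y -> x = y.
Proof. by move=> xy; apply: val_inj; apply/funext => v; exact: xy. Qed.

Lemma bary_continuous K v : continuous (fun x : realization R K => bary x v).
Proof.
apply: (@comp_continuous _ (prod_topology (fun _ : V => R)) _ set_val (fun t => t v)).
  exact: initial_continuous.
exact: (@proj_continuous V (fun=> R) v).
Qed.

Lemma continuous_baryP X K (f : X -> realization R K) :
  (forall v, continuous (fun x => bary (f x) v)) -> continuous f.
Proof.
move=> cf; apply: continuous_comp_initial => x.
apply/cvg_sup => v; apply: (@continuous_comp_initial _ _ _ (fun t : V -> R => t v)).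
exact: (cf v).
Qed.

Definition down_closed K := forall A B : {set V}, B \in K -> A \subset B -> A \in K.

Lemma sum_continuous X (I : finType) (F : I -> X -> R) (P : pred I) :
  (forall i, continuous (F i)) -> continuous (fun x => \sum_(i | P i) F i x).
Proof.
by move=> cF; apply: continuous_big => // x; exact: add_continuous.
Qed.

(** The way in which maps into a realization are built: unnormalized weights suffice, and dividing
    by their sum changes neither supports nor continuity. *)
Lemma normalized_map X K (F : X -> V -> R) :
  (forall v, continuous (F ^~ v)) -> (forall x v, 0 <= F x v) ->
  (forall x, 0 < \sum_v F x v) -> (forall x, supp (F x) \in K) ->
  exists f : X -> realization R K, continuous f /\
    forall x v, bary (f x) v = F x v / \sum_w F x w.
Proof.
move=> cF F0 Fpos FK.
have rF x : realization_set K (fun v => F x v / \sum_w F x w).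
  split=> [v||].
  - by rewrite divr_ge0 // ltW.
  - by rewrite -mulr_suml divff // gt_eqF.
  - suff -> : finset (fun v => F x v / \sum_w F x w != 0) = supp (F x) by [].
    apply/setP => v; rewrite !inE mulf_eq0 invr_eq0.
    by rewrite (gt_eqF (Fpos x)) orbF.
pose f x : realization R K := SigSub (mem_set (rF x)).
exists f; split; last by move=> x v; rewrite /bary set_valE.
apply: continuous_baryP => v.
rewrite (_ : (fun x => _) = (fun x => F x v / \sum_w F x w)); last first.
  by apply/funext => x; rewrite /bary set_valE.
move=> x; apply: cvgM; first exact: cF.
by apply: cvgV; [rewrite gt_eqF|exact: sum_continuous].
Qed.

Lemma supp_sub K (A : {set V}) (t : V -> R) : down_closed K -> A \in K ->
  (forall v, t v != 0 -> v \in A) -> supp t \in K.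
Proof.
by move=> dK AK tA; apply: dK AK _; apply/fintype.subsetP => v; rewrite inE => /tA.
Qed.

(** The segment from [f x] to [g x] stays in the simplex spanned by the two supports. *)
Lemma homotopic_line X K (f g : X -> realization R K) : down_closed K ->
  continuous f -> continuous g ->
  (forall x, supp (bary (f x)) :|: supp (bary (g x)) \in K) ->
  homotopic R f g.
Proof.
move=> dK cf cg fgK; apply/homotopicP.
pose F (z : X * R) v :=
  (1 - clamp z.2) * bary (f z.1) v + clamp z.2 * bary (g z.1) v.
have cc : continuous (fun z : X * R => clamp z.2).
  by apply: comp_continuous clamp_continuous; exact: snd_continuous.
have Fsum z : \sum_v F z v = 1.
  by rewrite big_split /= -!mulr_sumr !bary_sum !mulr1 subrK.
have F0 z v : 0 <= F z v.
  by rewrite addr_ge0 // mulr_ge0 ?bary_ge0 ?clamp_ge0 // subr_ge0 clamp_le1.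
have [||||H [cH HE]] := @normalized_map _ K F; rewrite //.
- move=> v z; apply: cvgD; apply: cvgM.
  + by apply: cvgB; [exact: cvg_cst|exact: cc].
  + by apply: (comp_continuous (comp_continuous (@fst_continuous X R) cf)
      (@bary_continuous K v)).
  + exact: cc.
  + by apply: (comp_continuous (comp_continuous (@fst_continuous X R) cg)
      (@bary_continuous K v)).
- by move=> z; rewrite Fsum.
- move=> z; apply: supp_sub (fgK z.1) _ => // v; rewrite !inE.
  by apply: contra_neqT; rewrite negb_or !negbK /F => /andP[/eqP-> /eqP->];
    rewrite !mulr0 addr0.
exists H; split=> // x; apply: bary_inj => v; rewrite HE Fsum divr1 /F /=.
  by rewrite clamp0 subr0 mul1r mul0r addr0.
by rewrite clamp1 subrr mul1r mul0r add0r.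
Qed.

(** [F] is a map onto coordinates of the smaller complex, with the inclusion as homotopy inverse. It
    need not fix [L] pointwise: sharing a simplex with the identity is enough for a straight-line
    homotopy, in [K] and in [L]. *)
Lemma realization_deformation K L (F : (V -> R) -> V -> R) :
  down_closed K -> down_closed L -> L \subset K ->
  (forall v, continuous (fun x : realization R K => F (bary x) v)) ->
  (forall (t : V -> R) v, (forall w, 0 <= t w) -> 0 <= F t v) ->
  (forall t : V -> R, (forall w, 0 <= t w) -> \sum_v F t v = \sum_v t v) ->
  (forall t : V -> R, (forall w, 0 <= t w) -> supp t \in K -> supp (F t) \in L) ->
  (forall t : V -> R, (forall w, 0 <= t w) -> supp t \in K -> supp t :|: supp
    (F t) \in K) ->
  (forall t : V -> R, (forall w, 0 <= t w) -> supp t \in L -> supp t :|: supp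
    (F t) \in L) ->
  homotopy_equivalent R (realization R K) (realization R L).
Proof.
move=> dK dL LK cF F0 Fsum FL FKK FLL.
have Fsum1 (x : realization R K) : \sum_v F (bary x) v = 1.
  by rewrite Fsum ?bary_sum //; exact: bary_ge0.
have [||||f [cf fE]] := @normalized_map (realization R K) L (fun x => F (bary
  x)); rewrite //.
- by move=> x v; apply: F0 => w; exact: bary_ge0.
- by move=> x; rewrite Fsum1.
- by move=> x; apply: FL; [exact: bary_ge0|exact: bary_supp].
have [||||g [cg gE]] := @normalized_map (realization R L) K (@bary L); rewrite //.
- exact: bary_continuous.
- exact: bary_ge0.
- by move=> x; rewrite bary_sum.
- by move=> x; apply: (fintype.subsetP LK); exact: bary_supp.
have {}fE x : bary (f x) = F (bary x).
  by apply/funext => v; rewrite fE Fsum1 divr1.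
have {}gE x : bary (g x) = bary x.
  by apply/funext => v; rewrite gE bary_sum divr1.
have cid (T : topologicalType) : continuous (@idfun T) by move=> *; exact: cvg_id.
exists f, g; split=> //; apply: homotopic_line => //;
  [exact: comp_continuous| |exact: comp_continuous|].
- move=> x /=; rewrite gE fE finset.setUC; apply: FKK;
    [exact: bary_ge0|exact: bary_supp].
- move=> x /=; rewrite fE gE finset.setUC; apply: FLL;
    [exact: bary_ge0|exact: bary_supp].
Qed.

End realization.

(** * Independence complexes *)

Section simplicial_maps.
Context {R : realType}.

(** The linear extension of a vertex map to barycentric coordinates. *)
Definition pushforward (V W : finType) (phi : V -> W) (t : V -> R) (w : W) : R :=
  \sum_(v | phi v == w) t v.

Lemma pushforward_ge0 (V W : finType) (phi : V -> W) (t : V -> R) w :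
  (forall v, 0 <= t v) -> 0 <= pushforward phi t w.
Proof. by move=> t0; apply: sumr_ge0. Qed.

Lemma pushforward_sum (V W : finType) (phi : V -> W) (t : V -> R) :
  \sum_w pushforward phi t w = \sum_v t v.
Proof. by rewrite [RHS](partition_big phi xpredT). Qed.

Lemma pushforward_comp (V W U : finType) (phi : V -> W) (psi : W -> U) t :
  pushforward psi (pushforward phi t) = pushforward (psi \o phi) t.
Proof.
apply/funext => u; rewrite /pushforward [RHS](partition_big phi (fun w => psi w
  == u)) //.
apply: eq_bigr => w /eqP <-; apply: eq_bigl => v /=.
by case: (phi v =P w) => [->|]; rewrite ?eqxx ?andbF.
Qed.

Lemma supp_pushforward (V W : finType) (phi : V -> W) (t : V -> R) :
  (forall v, 0 <= t v) -> supp (pushforward phi t) = phi @: supp t.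
Proof.
move=> t0; apply/setP => w; rewrite inE psumr_neq0 //; apply/hasP/imsetP.
  move=> [v _ /andP[/eqP <- tv]]; exists v => //.
  by rewrite inE gt_eqF.
move=> [v]; rewrite inE => tv ->; exists v; first exact: mem_index_enum.
by rewrite eqxx lt_neqAle eq_sym tv t0.
Qed.

(** Contiguous simplicial maps are homotopic along straight lines; here both composites are
    contiguous to the identity. *)
Lemma contiguous_equivalence (V W : finType) (K : {set {set V}})
    (L : {set {set W}}) (phi : V -> W) (psi : W -> V) :
  down_closed K -> down_closed L ->
  (forall A : {set V}, A \in K -> phi @: A \in L) ->
  (forall B : {set W}, B \in L -> psi @: B \in K) ->
  (forall A : {set V}, A \in K -> (psi \o phi) @: A :|: A \in K) ->
  (forall B : {set W}, B \in L -> (phi \o psi) @: B :|: B \in L) ->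
  homotopy_equivalent R (realization R K) (realization R L).
Proof.
move=> dK dL phiL psiK phiK psiL.
have cpush (V' W' : finType) (K' : {set {set V'}}) (h : V' -> W') w :
    continuous (fun x : realization R K' => pushforward h (bary x) w).
  by apply: sum_continuous => v; exact: bary_continuous.
have [||||f [cf fE]] :=
    @normalized_map R W (realization R K) L (fun x => pushforward phi (bary x)).
- exact: cpush.
- by move=> x v; apply: pushforward_ge0; exact: bary_ge0.
- by move=> x; rewrite pushforward_sum bary_sum.
- move=> x; rewrite supp_pushforward; last exact: bary_ge0.
  by apply: phiL; exact: bary_supp.
have [||||g [cg gE]] :=
    @normalized_map R V (realization R L) K (fun x => pushforward psi (bary x)).
- exact: cpush.
- by move=> x v; apply: pushforward_ge0; exact: bary_ge0.
- by move=> x; rewrite pushforward_sum bary_sum.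
- move=> x; rewrite supp_pushforward; last exact: bary_ge0.
  by apply: psiK; exact: bary_supp.
have {}fE x : bary (f x) = pushforward phi (bary x).
  by apply/funext => v; rewrite fE pushforward_sum bary_sum divr1.
have {}gE x : bary (g x) = pushforward psi (bary x).
  by apply/funext => v; rewrite gE pushforward_sum bary_sum divr1.
have cid (T : topologicalType) : continuous (@idfun T) by move=> *; exact: cvg_id.
exists f, g; split=> //; apply: homotopic_line => //.
- exact: comp_continuous.
- move=> x /=; rewrite gE fE pushforward_comp supp_pushforward; last exact: bary_ge0.
  by apply: phiK; exact: bary_supp.
- exact: comp_continuous.
- move=> x /=; rewrite fE gE pushforward_comp supp_pushforward; last exact: bary_ge0.
  by apply: psiL; exact: bary_supp.
Qed.

End simplicial_maps.

Section independence_complexes.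
Context {R : realType}.

(** Vertices are deleted by shrinking [S], so that the vertex type stays the same through all
    moves. *)
Definition ind (V : finType) (S : {set V}) (e : rel V) : {set {set V}} :=
  finset (fun A : {set V} =>
    (A \subset S) && [forall x in A, forall y in A, ~~ e x y]).

Lemma indP (V : finType) (S : {set V}) (e : rel V) (A : {set V}) :
  reflect ((forall x, x \in A -> x \in S) /\
           (forall x y, x \in A -> y \in A -> ~~ e x y)) (A \in ind S e).
Proof.
rewrite inE; apply: (iffP andP) => -[/fintype.subsetP AS Ae]; split => //.
  by move=> x y xA yA; move/forall_inP: Ae => /(_ x xA) /forall_inP; exact.
by apply/forall_inP => x xA; apply/forall_inP => y yA; exact: Ae.
Qed.

Lemma independence_complexE (V : finType) (e : rel V) :
  independence_complex e = ind [set: V]%SET e.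
Proof. by apply/setP => A; rewrite !inE finset.subsetT. Qed.

Lemma ind_down_closed (V : finType) (S : {set V}) (e : rel V) :
  down_closed (ind S e).
Proof.
move=> A B /indP[BS Be] /fintype.subsetP AB; apply/indP; split.
  by move=> x /AB /BS.
by move=> x y /AB xB /AB; exact: Be.
Qed.

Lemma eq_ind (V : finType) (S : {set V}) (e e' : rel V) :
  {in S &, e =2 e'} -> ind S e = ind S e'.
Proof.
move=> ee; apply/setP => A; apply/indP/indP => -[AS Ae]; split => // x y xA yA.
  by rewrite -ee ?AS //; exact: Ae.
by rewrite ee ?AS //; exact: Ae.
Qed.

Lemma ind_isomorphic (V W : finType) (S : {set V}) (T : {set W})
    (e : rel V) (e' : rel W) (phi : V -> W) (psi : W -> V) :
  (forall v, v \in S -> phi v \in T) -> (forall w, w \in T -> psi w \in S) ->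
  {in S, cancel phi psi} -> {in T, cancel psi phi} ->
  {in S &, forall v v', e' (phi v) (phi v') = e v v'} ->
  homotopy_equivalent R (realization R (ind S e)) (realization R (ind T e')).
Proof.
move=> phiT psiS phiK psiK eE.
apply: (contiguous_equivalence (phi := phi) (psi := psi)).
- exact: ind_down_closed.
- exact: ind_down_closed.
- move=> A /indP[AS Ae]; apply/indP; split.
    by move=> _ /imsetP[x xA ->]; exact/phiT/AS.
  move=> _ _ /imsetP[x xA ->] /imsetP[y yA ->].
  by rewrite eE ?AS //; exact: Ae.
- move=> A /indP[AS Ae]; apply/indP; split.
    by move=> _ /imsetP[x xA ->]; exact/psiS/AS.
  move=> _ _ /imsetP[x xA ->] /imsetP[y yA ->].
  by rewrite -eE ?psiS ?psiK ?AS //; exact: Ae.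
- move=> A /[dup] AK /indP[AS _]; rewrite (_ : _ :|: A = A) //.
  apply/finset.setUidPr/fintype.subsetP => _ /imsetP[x xA ->] /=.
  by rewrite phiK // AS.
- move=> A /[dup] AK /indP[AS _]; rewrite (_ : _ :|: A = A) //.
  apply/finset.setUidPr/fintype.subsetP => _ /imsetP[x xA ->] /=.
  by rewrite psiK // AS.
Qed.

(** * Moves on graphs that keep the homotopy type *)

Section moves.
Context {V : finType}.
Implicit Types (S T : {set V}) (e : rel V).

(** Each vertex moves to one whose neighbours in [S] are among its own. A simplex therefore stays
    independent when its image is added: an edge at an image would come from an edge already
    present. All vertices are moved at once. *)
Lemma fold_equivalence S T e (phi : V -> V) : symmetric e -> T \subset S ->
  (forall v, v \in S -> phi v \in T) ->
  (forall v w, v \in S -> w \in S -> e w (phi v) -> e w v) ->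
  homotopy_equivalent R (realization R (ind S e)) (realization R (ind T e)).
Proof.
move=> es /fintype.subsetP TS phiT phie.
have phiA (U : {set V}) (A : {set V}) : (forall v, v \in U -> v \in S) ->
    (forall v, v \in U -> phi v \in U) ->
    A \in ind U e -> phi @: A :|: A \in ind U e.
  move=> US phiU /indP[AU Ae]; apply/indP; split.
    by move=> v /finset.setUP[/imsetP[w wA ->]|]; [exact/phiU/AU|exact: AU].
  have phin w v : w \in A -> v \in A -> ~~ e w (phi v).
    move=> wA vA; apply: contraTN (Ae _ _ wA vA) => /phie; rewrite negbK.
    by apply; exact/US/AU.
  move=> x y /finset.setUP[/imsetP[w wA ->]|xA] /finset.setUP[/imsetP[v vA ->]|yA].
  - apply/negP => /phie; rewrite es => /(_ (US _ (AU _ vA)) (TS _ (phiT _ (US _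
      (AU _ wA))))).
    by apply/negP; exact: phin.
  - by rewrite es; exact: phin.
  - exact: phin.
  - exact: Ae.
apply: (contiguous_equivalence (phi := phi) (psi := id)).
- exact: ind_down_closed.
- exact: ind_down_closed.
- move=> A AK; have /indP[_ Ae] := phiA S A (fun _ => id) (fun v vS => TS _
    (phiT v vS)) AK.
  move/indP: AK => [AS _]; apply/indP; split.
    by move=> _ /imsetP[v /AS vS ->]; exact: phiT.
  by move=> v w vA wA; apply: Ae; rewrite inE ?vA ?wA.
- move=> A /indP[AT Ae]; rewrite imset_id; apply/indP; split=> //.
  by move=> x /AT/TS.
- by move=> A AK; apply: phiA => // v vS; exact/TS/phiT.
- by move=> A AK; apply: phiA => // v /TS; exact: phiT.
Qed.

Lemma sum_indicator (v : V) : \sum_w (w == v)%:R = 1 :> R.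
Proof. by rewrite (bigD1 v) //= eqxx big1 ?addr0 // => i /negbTE ->. Qed.

Lemma supp_indicator (v : V) : supp (fun w => (w == v)%:R : R) = [set v]%SET.
Proof. by apply/setP => w; rewrite !inE pnatr_eq0 eqb0 negbK. Qed.

Lemma vertex_point S e v : v \in S -> ~~ e v v ->
  exists x : realization R (ind S e), bary x = fun w => (w == v)%:R.
Proof.
move=> vS ev.
have [||||x0 [_ x0E]] := @normalized_map R V R (ind S e) (fun _ w => (w == v)%:R).
- by move=> w x; exact: cvg_cst.
- by move=> _ w; exact: ler0n.
- by move=> _; rewrite sum_indicator.
- move=> _; rewrite supp_indicator; apply/indP.
  split=> [w|w w']; rewrite !inE => /eqP -> //.
  by move=> /eqP ->; exact: ev.
by exists (x0 0); apply/funext => w; rewrite x0E sum_indicator divr1.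
Qed.

(** The complex is a cone with apex [v], and straight lines lead to the apex. *)
Lemma isolated_vertex_contractible S e v : symmetric e -> v \in S ->
  (forall w, w \in S -> ~~ e w v) -> contractible R (realization R (ind S e)).
Proof.
move=> es vS ev; have [x0 x0E] := vertex_point vS (ev v vS).
exists x0; apply: homotopic_line.
- exact: ind_down_closed.
- by move=> x; exact: cvg_id.
- by move=> x; exact: (@cst_continuous _ _ x0).
move=> x /=; rewrite x0E supp_indicator; have /indP[xS xe] := bary_supp x.
apply/indP; split=> [w /finset.setUP[/xS//|/finset.set1P->//]|].
move=> w w' /finset.setUP[wx|/finset.set1P->] /finset.setUP[wx'|/finset.set1P->].
- exact: xe.
- exact/ev/xS.
- by rewrite es; exact/ev/xS.
- exact: ev.
Qed.

Definition add_edge e (u v : V) : rel V :=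
  fun x y => [|| e x y, (x == u) && (y == v) | (x == v) && (y == u)].

Lemma add_edge_sym e u v : symmetric e -> symmetric (add_edge e u v).
Proof.
move=> es x y; rewrite /add_edge es; congr (_ || _).
by rewrite orbC andbC; congr (_ || _); rewrite andbC.
Qed.

(* Push the points of the open star of the edge [uv] towards the cone point [w]
   of its link. *)
Lemma add_edge_equivalence S e u v w : symmetric e -> u != v ->
  w \in S -> w != u -> w != v -> ~~ e w w -> ~~ e u w -> ~~ e v w ->
  (forall x, x \in S -> e x w -> e x u || e x v) ->
  homotopy_equivalent R (realization R (ind S e))
    (realization R (ind S (add_edge e u v))).
Proof.
move=> es uv wS wu wv eww euw evw ew.
(* The smaller of the two weights is taken off both [u] and [v], so that one of them is emptied, and
   twice this amount goes to [w], which preserves the total. Where [u] or [v] carries no weight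
   already, nothing moves. *)
pose F (t : V -> R) x := t x - (x == u)%:R * Num.min (t u) (t v)
  - (x == v)%:R * Num.min (t u) (t v) + (x == w)%:R * (2 * Num.min (t u) (t v)).
have F0 (t : V -> R) x : (forall y, 0 <= t y) -> 0 <= F t x.
  move=> t0; have m0 : 0 <= Num.min (t u) (t v) by rewrite le_min !t0.
  rewrite addr_ge0 //; last by rewrite !mulr_ge0.
  have [->|xu] := eqVneq x u.
    by rewrite (negbTE uv) mul0r subr0 mul1r subr_ge0 ge_min lexx.
  rewrite mul0r subr0; have [->|xv] := eqVneq x v; last by rewrite mul0r subr0.
  by rewrite mul1r subr_ge0 ge_min lexx orbT.
have Fid (t : V -> R) : Num.min (t u) (t v) = 0 -> F t = t.
  by move=> m0; apply/funext => x; rewrite /F m0 !mulr0 !subr0 addr0.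
have Fsupp (t : V -> R) x : F t x != 0 -> (t x != 0) || (x == w) || (x == u) ||
  (x == v).
  apply: contra_neqT; rewrite !negb_or negbK => /andP[/andP[/andP[/eqP tx xw] xu] xv].
  by rewrite /F tx (negbTE xw) (negbTE xu) (negbTE xv) !mul0r !subr0 addr0.
have cone (t : V -> R) A : (forall y, 0 <= t y) -> t u != 0 -> t v != 0 ->
    A = supp t -> A \in ind S e -> w |: A \in ind S e.
  move=> t0 tu tv -> /indP[tS te]; apply/indP; split=> [x /setU1P[->//|/tS//]|].
  have nw x : x \in supp t -> ~~ e x w.
    move=> xt; apply/negP => /(ew _ (tS _ xt)).
    by rewrite (negbTE (te _ _ xt _)) ?inE // (negbTE (te _ _ xt _)) ?inE.
  move=> x y /setU1P[->|xt] /setU1P[->|yt] //.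
  - by rewrite es; exact: nw.
  - exact: nw.
  - exact: te.
have m_neq0 (t : V -> R) : (forall y, 0 <= t y) -> Num.min (t u) (t v) != 0 ->
    t u != 0 /\ t v != 0.
  move=> t0 m0; have m0' : 0 < Num.min (t u) (t v).
    by rewrite lt_neqAle eq_sym m0 le_min !t0.
  by move: m0'; rewrite lt_min => /andP[tu tv]; rewrite !gt_eqF.
have Fsub (t : V -> R) : (forall y, 0 <= t y) -> Num.min (t u) (t v) != 0 ->
    supp t :|: supp (F t) \subset w |: supp t.
  move=> t0 /(m_neq0 _ t0)[tu tv]; apply/fintype.subsetP => x.
  move=> /finset.setUP[xt|]; first by rewrite !inE in xt *; rewrite xt orbT.
  rewrite inE => /Fsupp; rewrite !inE => /orP[/orP[/orP[->|->]|/eqP->]|/eqP->] //;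
    by rewrite ?tu ?tv ?orbT.
have FK (t : V -> R) : (forall y, 0 <= t y) -> supp t \in ind S e ->
    supp t :|: supp (F t) \in ind S e.
  move=> t0 tK; have [m0|m0] := eqVneq (Num.min (t u) (t v)) 0.
    by rewrite Fid // finset.setUid.
  have [tu tv] := m_neq0 _ t0 m0.
  apply: ind_down_closed (Fsub _ t0 m0); exact: (cone t (supp t)).
have LK : ind S (add_edge e u v) \subset ind S e.
  apply/fintype.subsetP => A /indP[AS Ae]; apply/indP; split=> // x y xA yA.
  by have := Ae x y xA yA; rewrite /add_edge negb_or => /andP[].
apply: (@realization_deformation _ _ _ _ F) => //.
- exact: ind_down_closed.
- exact: ind_down_closed.
- move=> x; have cm : continuous (fun z : realization R (ind S e) =>
      Num.min (bary z u) (bary z v)).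
    by apply: min_fun_continuous; exact: bary_continuous.
  apply: add_fun_continuous; first apply: sub_fun_continuous;
    first apply: sub_fun_continuous.
  + exact: bary_continuous.
  + by apply: mul_fun_continuous cm; exact: cst_fun_continuous.
  + by apply: mul_fun_continuous cm; exact: cst_fun_continuous.
  + apply: mul_fun_continuous; first exact: cst_fun_continuous.
    by apply: mul_fun_continuous cm; exact: cst_fun_continuous.
- move=> t _; rewrite /F big_split /= !sumrB -!mulr_suml.
  by rewrite !sum_indicator !mul1r mulr_natl mulr2n addrA !subrK.
- move=> t t0 tK.
  have /indP[FS Fe] : supp (F t) \in ind S e.
    by apply: ind_down_closed (FK t t0 tK) _; exact: finset.subsetUr.
  apply/indP; split=> // x y xF yF; rewrite /add_edge negb_or Fe //=.
  have Fuv : (F t u == 0) || (F t v == 0).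
    rewrite /F !eqxx (eq_sym v u) (negbTE uv) (eq_sym u w) (eq_sym v w).
    rewrite (negbTE wu) (negbTE wv) !mul0r !mul1r !addr0 !subr0.
    by rewrite !subr_eq0 /Num.min; case: ifP => _; rewrite eqxx ?orbT.
  move: xF yF; rewrite !inE => xF yF.
  apply/negP => /orP[] /andP[/eqP xE /eqP yE]; move: xF yF; rewrite xE yE => xF yF;
   by move: Fuv; rewrite (negbTE xF) (negbTE yF).
- move=> t t0 tL; rewrite Fid ?finset.setUid //.
  apply/eqP; apply/negPn/negP => /(m_neq0 _ t0)[tu tv].
  have /indP[_ /(_ u v)] := tL.
  by rewrite !inE tu tv /add_edge !eqxx /= orbT => /(_ isT isT).
Qed.

(* [b2] is a cone point of the link of [xy] and, once [xy] is an edge, [b1] is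
   one of the link of [b3 y]; finally [b1] folds onto [b3]. *)
Lemma path_contraction S e e' x b1 b2 b3 y : symmetric e -> symmetric e' ->
  irreflexive e ->
  uniq [:: x; b1; b2; b3; y] -> {subset [:: x; b1; b2; b3; y] <= S} ->
  (forall z, z \in S -> e b1 z = (z == x) || (z == b2)) ->
  (forall z, z \in S -> e b2 z = (z == b1) || (z == b3)) ->
  (forall z, z \in S -> e b3 z = (z == b2) || (z == y)) ->
  (forall z, z \in S :\ b1 -> e' b3 z = (z == b2)) -> e' x y ->
  (forall p q, p \in S :\ b1 -> q \in S :\ b1 -> p != b3 -> q != b3 ->
     ~~ ((p == x) && (q == y)) -> ~~ ((p == y) && (q == x)) -> e' p q = e p q) ->
  homotopy_equivalent R (realization R (ind S e)) (realization R (ind (S :\ b1) e')).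
Proof.
move=> es es' ei; rewrite /= !inE !negb_or.
move=> /and5P[/and4P[xb1 xb2 xb3 xy] /and3P[b12 b13 b1y] /andP[b23 b2y] b3y _] sS.
have [xS b1S b2S b3S yS] : [/\ x \in S, b1 \in S, b2 \in S, b3 \in S & y \in S].
  by split; apply: sS; rewrite !inE eqxx ?orbT.
move=> eb1 eb2 eb3 eb3' exy' eE.
apply: (@homotopy_equivalent_trans _ (realization R (ind S (add_edge e x y)))).
  apply: (add_edge_equivalence (w := b2)) => //.
  - by rewrite eq_sym.
  - by rewrite ei.
  - by rewrite es eb2 // (negbTE xb1) (negbTE xb3).
  - by rewrite es eb2 // ![y == _]eq_sym (negbTE b1y) (negbTE b3y).
  - move=> z zS; rewrite es eb2 // => /orP[]/eqP->.
      by rewrite eb1 // eqxx.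
    by rewrite eb3 // [e _ y]eb3 // eqxx !orbT.
(* The edge [b3 y] is removed by the addition move read backwards, so the link is examined in [e2],
   where the edge is absent. *)
pose e2 p q := add_edge e x y p q && ~~ ((p == b3) && (q == y)) && ~~ ((p == y)
  && (q == b3)).
have e2s : symmetric e2.
  move=> p q; rewrite /e2 (add_edge_sym _ _ es) -!andbA; congr (_ && _).
  by rewrite andbC; congr (~~ _ && ~~ _); rewrite andbC.
apply: (@homotopy_equivalent_trans _ (realization R (ind S e2))).
  apply: homotopy_equivalent_sym.
  rewrite (_ : ind S (add_edge e x y) = ind S (add_edge e2 b3 y)); last first.
    apply: eq_ind => p q pS qS; rewrite /e2 {2}/add_edge.
    have [/andP[/eqP-> /eqP->]|_] /= := boolP ((p == b3) && (q == y)).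
      by rewrite /add_edge eb3 // eqxx orbT.
    have [/andP[/eqP-> /eqP->]|_] /= := boolP ((p == y) && (q == b3)).
      by rewrite /add_edge es eb3 // eqxx !orbT.
    by rewrite !andbT !orbF.
  apply: (add_edge_equivalence (w := b1)) => //.
  - by rewrite /e2 /add_edge ei (negbTE b1y) [b1 == x]eq_sym (negbTE xb1).
  - rewrite /e2 /add_edge es eb1 // [b3 == x]eq_sym [b3 == b2]eq_sym.
    by rewrite (negbTE xb3) (negbTE b23) (negbTE b3y).
  - rewrite /e2 /add_edge es eb1 // ![y == _]eq_sym.
    by rewrite (negbTE xy) (negbTE b2y) [b1 == x]eq_sym (negbTE xb1) andbF.
  - move=> z zS /andP[/andP[+ _] _]; rewrite /add_edge es eb1 //.
    rewrite (negbTE b1y) [b1 == x]eq_sym (negbTE xb1) !andbF !orbF => /orP[]/eqP->.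
      by rewrite /e2 /add_edge !eqxx (negbTE xb3) (negbTE xy) /= !orbT.
    by rewrite /e2 /add_edge eb2 // eqxx (negbTE b23) (negbTE b2y) orbT.
rewrite (_ : ind (S :\ b1) e' = ind (S :\ b1) e2); last first.
  have e2b3 z : z \in S :\ b1 -> e2 b3 z = (z == b2).
    move=> /setD1P[_ zS]; rewrite /e2 /add_edge eb3 // (negbTE b3y) [b3 == x]eq_sym.
    rewrite (negbTE xb3) eqxx /= !orbF andbT.
    by have [->|] := eqVneq z b2; rewrite ?b2y //= andbN.
  apply: eq_ind => p q pS qS.
  have [->|pb3] := eqVneq p b3; first by rewrite eb3' // e2b3.
  have [->|qb3] := eqVneq q b3; first by rewrite es' e2s eb3' // e2b3.
  have [/andP[/eqP-> /eqP->]|n1] := boolP ((p == x) && (q == y)).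
    by rewrite exy' /e2 /add_edge !eqxx (negbTE xb3) (negbTE xy) /= orbT.
  have [/andP[/eqP-> /eqP->]|n2] := boolP ((p == y) && (q == x)).
    by rewrite es' exy' /e2 /add_edge !eqxx (eq_sym y b3) (negbTE b3y) (negbTE
      xb3) /= !orbT.
  by rewrite eE // /e2 /add_edge (negbTE n1) (negbTE n2) !orbF (negbTE pb3)
    (negbTE qb3) !andbF !andbT.
(* By now [b2] is the only neighbour of [b3], and it is a neighbour of [b1] too. *)
apply: (fold_equivalence (phi := fun v => if v == b1 then b3 else v)) => //.
- exact: subD1set.
- move=> v vS; case: ifP => [_|/negbT vb1]; rewrite !inE ?vS ?vb1 ?b3S //.
  by rewrite eq_sym b13.
- move=> v w vS wS; case: ifP => [/eqP-> /andP[/andP[ew _] nw]|//].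
  move: ew nw; rewrite /add_edge es eb3 // eqxx andbT [b3 == x]eq_sym (negbTE xb3).
  rewrite (negbTE b3y) !andbF !orbF => /orP[/eqP-> _|/eqP->]; last by rewrite eqxx.
  by rewrite /e2 /add_edge eb2 // eqxx (negbTE b23) (negbTE b2y).
Qed.

End moves.

End independence_complexes.

(** * Wedges *)

Section wedge_decomposition.
Context {R : realType} {I : finType} {X : topologicalType}
  {Y : I -> topologicalType}.
Variables (D : I -> set X) (x0 : X) (inn : forall i, Y i -> X)
  (out : forall i, X -> Y i) (H : X * R -> X).
Hypotheses (D_closed : forall i, closed (D i))
  (D_cover : forall x, exists i, D i x) (D_x0 : forall i, D i x0)
  (inn_continuous : forall i, continuous (@inn i))
  (inn_D : forall i y, D i (@inn i y)) (innK : forall i, cancel (@inn i) (@out i))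
  (out_continuous : forall i x, D i x -> {for x, continuous (@out i)})
  (outK : forall i x, D i x -> inn (out i x) = x)
  (H_continuous : continuous H) (H0 : forall x, H (x, 0) = x)
  (H_x0 : forall s, H (x0, s) = x0)
  (H_D : forall i x s, D i x -> D i (H (x, s)))
  (H1 : forall i j x, i != j -> D i x -> D j x -> H (x, 1) = x0)
  (x0_closed : forall i, closed [set out i x0]).

Let p i : Y i := out i x0.
Let W := wedge p.
Let lift i (y : Y i) : W := @wedge_lift _ _ p i y.

Let lift_p i j : lift (p i) = lift (p j).
Proof. exact: wedge_liftE. Qed.

Let wedgeP (w : W) : exists i (y : Y i), w = lift y.
Proof.
have : [set: W] w by [].
by rewrite -wedgeTE => -[i _ [y _ <-]]; exists i, y.
Qed.

Let collapse : W -> X := wedge_fun inn.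

Let inn_p i j : inn (p i) = inn (p j).
Proof. by rewrite /p !outK. Qed.

Let collapseE i (y : Y i) : collapse (lift y) = inn y.
Proof. exact: wedge_lift_funE. Qed.

(** An arbitrary choice among the pieces through [x]. It does not affect [spread]: a point in two
    pieces ends at [x0], which becomes the base point of every summand. *)
Let piece x : I := projT1 (cid (D_cover x)).

Let spread x : W := lift (out (piece x) (H (x, 1))).

Let spreadE i x : D i x -> spread x = lift (out i (H (x, 1))).
Proof.
move=> Dix; rewrite /spread /piece; case: cid => j Djx /=.
have [->//|ji] := eqVneq j i.
by rewrite (H1 ji Djx Dix); exact: lift_p.
Qed.

Let spread_continuous : continuous spread.
Proof.
apply: (@continuous_finite_closed_cover _ _ I D) => // i.
apply: (@subspace_eq_continuous _ _ _ (fun x => lift (out i (H (x, 1)))) spread).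
  by move=> x; rewrite inE => /spreadE ->.
apply: continuous_in_subspaceT => x; rewrite inE => Dix.
apply: (@continuous_comp _ _ _ (fun x => out i (H (x, 1))) (@lift i));
  last exact: wedge_lift_continuous.
apply: (@continuous_comp _ _ _ (fun x => H (x, 1)) (out i));
  last exact/out_continuous/H_D.
suff : continuous (fun x => H (x, 1)) by exact.
apply: comp_continuous H_continuous.
by apply: pair_continuous; [move=> ?; exact: cvg_id|exact: cst_fun_continuous].
Qed.

Let track (s : R) i (y : Y i) : W := lift (out i (H (inn y, s))).

Let track_p s i j : track s (p i) = track s (p j).
Proof. by rewrite /track /p !outK // H_x0; exact: lift_p. Qed.

Let G (z : W * R) : W := wedge_fun (@track z.2) z.1.

Let GE s i (y : Y i) : G (lift y, s) = lift (out i (H (inn y, s))).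
Proof. exact: (wedge_lift_funE _ (@track_p s)). Qed.

Let wedge_prodE i (y : Y i) : wedge_prod (lift y) i = y.
Proof.
by rewrite /wedge_prod wedge_lift_funE ?dfwithin //; exact: wedge_prod_pointE.
Qed.

Let wedge_prod_out i j (y : Y i) : i != j -> wedge_prod (lift y) j = p j.
Proof.
move=> ij; rewrite /wedge_prod wedge_lift_funE ?dfwithout //.
exact: wedge_prod_pointE.
Qed.

Let wedge_prod_coord_continuous i : continuous (fun w : W => wedge_prod w i).
Proof.
apply: (@comp_continuous W (prod_topology Y) (Y i) (@wedge_prod _ _ p) (fun t => t i)).
  exact: wedge_prod_continuous.
exact: (@proj_continuous _ Y i).
Qed.

(** The [i]-th summand times [R], cut out by the coordinates of the wedge in the product; closedness
    then comes from that of the base points. *)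
Let branch i : set (W * R) := [set z | forall j, j != i -> wedge_prod z.1 j = p j].

Let branchP i z : branch i z -> z.1 = lift (wedge_prod z.1 i).
Proof.
move: z => [w s] /=; have [j [y ->]] := wedgeP w; rewrite /branch /=.
have [<- _|ji /(_ j ji)] := eqVneq j i; first by rewrite wedge_prodE.
by rewrite wedge_prodE => ->; rewrite wedge_prod_out //; exact: lift_p.
Qed.

Let G_continuous : continuous G.
Proof.
apply: (@continuous_finite_closed_cover _ _ I branch) => [i|[w s]|i].
- rewrite (_ : branch i = \bigcap_(j in [set j | j != i])
      ((fun z : W * R => wedge_prod z.1 j) @^-1` [set p j])); last first.
    by apply/seteqP; split=> z /= zP j; exact: zP.
  apply: closed_bigI => j _; apply: (@preimage_closed _ _ (fun z : W * R =>
    wedge_prod z.1 j)) => //.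
  move=> z _; suff : continuous (fun z : W * R => wedge_prod z.1 j) by exact.
  exact: (comp_continuous (@fst_continuous W R) (@wedge_prod_coord_continuous j)).
- have [i [y ->]] := wedgeP w; exists i => j ji /=.
  by rewrite wedge_prod_out // eq_sym.
- pose Gi (z : W * R) := lift (out i (H (inn (wedge_prod z.1 i), z.2))).
  apply: (@subspace_eq_continuous _ _ _ Gi G).
    by move=> [w s]; rewrite inE => /branchP /= wE; rewrite wE GE /Gi /= -wE.
  apply: continuous_subspaceT => z.
  apply: (@continuous_comp _ _ _ (fun z : W * R => out i (H (inn (wedge_prod
    z.1 i), z.2))) (@lift i));
    last exact: wedge_lift_continuous.
  apply: (@continuous_comp _ _ _ (fun z : W * R => H (inn (wedge_prod z.1 i),
    z.2)) (out i));
    last exact/out_continuous/H_D/inn_D.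
  apply: comp_continuous H_continuous z.
  apply: pair_continuous; last exact: snd_continuous.
  apply: comp_continuous (@inn_continuous i).
  exact: (comp_continuous (@fst_continuous W R) (@wedge_prod_coord_continuous i)).
Qed.

(** [collapse] glues the inclusions of the pieces, and [spread] runs [H] to its end before sorting
    points into summands. One composite is joined to the identity by [H] itself. The other is joined
    by [G], which is [H] carried over to the wedge; this makes sense because [H] preserves each
    piece and fixes [x0]. *)
Lemma wedge_decomposition : homotopy_equivalent R X (wedge (fun i => out i x0)).
Proof.
exists spread, collapse; split => //.
- exact: wedge_fun_continuous.
- apply: homotopic_sym; apply/homotopicP; exists H; split=> // x /=.
  have [i Dix] := D_cover x.
  by rewrite (spreadE Dix) collapseE outK //; exact: H_D.
- apply: homotopic_sym; apply/homotopicP; exists G; split=> // w /=;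
    have [i [y ->]] := wedgeP w; rewrite GE.
    by rewrite H0 innK.
  by rewrite collapseE (spreadE (inn_D y)).
Qed.

End wedge_decomposition.

(** * Cross-polytopes *)

Section spheres.
Context {R : realType}.

Definition sphere_coord n (y : sphere R n) (i : 'I_n.+1) : R :=
  (set_val y : 'rV[R]_n.+1) ord0 i.

Lemma sphere_coord_sum n (y : sphere R n) : \sum_i sphere_coord y i ^+ 2 = 1.
Proof. exact: (set_valP y). Qed.

Lemma sphere_coord_inj n (y z : sphere R n) :
  sphere_coord y =1 sphere_coord z -> y = z.
Proof.
by move=> yz; apply: val_inj; apply/rowP => i; have := yz i;
  rewrite /sphere_coord !set_valE.
Qed.

Lemma sphere_coord_continuous n i : continuous (fun y : sphere R n => sphere_coord y i).
Proof.
apply: (@comp_continuous _ 'rV[R]_n.+1 _ set_val (fun t => t ord0 i)).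
  exact: initial_continuous.
exact: coord_continuous.
Qed.

Lemma sphere_continuous_at (X : topologicalType) n (f : X -> sphere R n) x :
  (forall i, {for x, continuous (fun z => sphere_coord (f z) i)}) ->
  {for x, continuous f}.
Proof.
move=> cf U [? /= [[A oA <-]]] /= Afx /filterS; apply.
suff cvf : set_val (f z) @[z --> x] --> set_val (f x).
  by apply: cvf; exact: open_nbhs_nbhs.
apply/cvg_mx_entourageP => E entE.
suff : \forall z \near x, forall j, (sphere_coord (f x) j, sphere_coord (f z) j) \in E.
  by apply: filterS => z zE i j; rewrite (ord1 i); exact: zE.
apply: filter_forall => j; have cfj : sphere_coord (f z) j @[z --> x] -->
  sphere_coord (f x) j by exact: cf.
move/cvg_entourageP: cfj => /(_ E entE).
by rewrite near_simpl; apply: filterS => z; rewrite inE.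
Qed.

Lemma sphere_closed1 n (y : sphere R n) : closed [set y].
Proof.
rewrite (_ : [set y] = set_val @^-1` [set (set_val y : 'rV[R]_n.+1)]).
  apply: preimage_closed; first by move=> z _; apply: initial_continuous.
  exact/accessible_closed_set1/hausdorff_accessible/norm_hausdorff.
by apply/seteqP; split=> z /= [] => [->//|zy]; apply: val_inj.
Qed.

Lemma sphere_default n : sphere R n.
Proof.
suff S0 : sphere R n (\row_(j < n.+1) (j == ord0)%:R) by exact: (SigSub (mem_set S0)).
rewrite /sphere /= (bigD1 ord0) //= big1 ?addr0 ?mxE ?eqxx ?expr1n //.
by move=> i /negbTE; rewrite mxE => ->; rewrite expr0n.
Qed.

Lemma sphere_of n (x : 'I_n.+1 -> R) : 0 < \sum_i x i ^+ 2 ->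
  exists y : sphere R n, forall i, sphere_coord y i = x i / Num.sqrt (\sum_i x i ^+ 2).
Proof.
move=> x0; set c := Num.sqrt _.
have Sx : sphere R n (\row_j (x j / c)).
  rewrite /sphere /=; under eq_bigr do rewrite mxE expr_div_n.
  by rewrite -mulr_suml /c sqr_sqrtr ?ltW // divff // gt_eqF.
by exists (SigSub (mem_set Sx)) => i; rewrite /sphere_coord set_valE /= mxE.
Qed.

End spheres.

Section subcomplex.
Context {R : realType} {V : finType}.

Definition subcomplex (K : {set {set V}}) (T : {set V}) : set (realization R K) :=
  [set x | forall v, v \notin T -> bary x v = 0].

Lemma subcomplex_closed K T : closed (@subcomplex K T).
Proof.
rewrite (_ : subcomplex T = \bigcap_(v in [set v | v \notin T])
    ((fun x : realization R K => bary x v) @^-1` [set 0])); last first.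
  by apply/seteqP; split=> x /= xT v vT; exact: xT.
apply: closed_bigI => v _; apply: preimage_closed.
  by move=> x _; exact: bary_continuous.
exact/accessible_closed_set1/hausdorff_accessible/norm_hausdorff.
Qed.

End subcomplex.

(** A homeomorphism between a sphere and [D]. The inverse is defined on the whole space, with
    continuity asked at the points of [D], so that [D] need not be made a space of its own. *)
Record sphere_chart {R : realType} {X : topologicalType} (D : set X) := SphereChart {
  chart_dim : nat;
  chart_in : sphere R chart_dim -> X;
  chart_out : X -> sphere R chart_dim;
  chart_in_continuous : continuous chart_in;
  chart_in_D : forall y, D (chart_in y);
  chart_inK : cancel chart_in chart_out;
  chart_out_continuous : forall x, D x -> {for x, continuous chart_out};
  chart_outK : forall x, D x -> chart_in (chart_out x) = x }.
Arguments sphere_chart R {X} D.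

Section cross_polytope.
Context {R : realType} {V : finType}.
Variables (K : {set {set V}}) (n : nat) (P N : 'I_n.+1 -> V).
Hypotheses (P_inj : injective P) (N_inj : injective N)
  (PN : forall i j, P i != N j).

Let T : {set V} := P @: 'I_n.+1 :|: N @: 'I_n.+1.

Hypothesis KT : forall A : {set V}, A \subset T ->
  (A \in K) = [forall i, ~~ ((P i \in A) && (N i \in A))].

Local Notation cross_polytope := (@subcomplex R V K T).

Let PT i : P i \in T. Proof. by rewrite inE imset_f. Qed.
Let NT i : N i \in T. Proof. by rewrite inE imset_f ?orbT. Qed.

Let TP v : v \in T -> exists i, v = P i \/ v = N i.
Proof. by case/finset.setUP => /imsetP[i _ ->]; exists i; [left|right]. Qed.

Let F (y : sphere R n) (v : V) : R :=
  \sum_i ((v == P i)%:R * Num.max 0 (sphere_coord y i) +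
          (v == N i)%:R * Num.max 0 (- sphere_coord y i)).

Let FP y i : F y (P i) = Num.max 0 (sphere_coord y i).
Proof.
rewrite /F (bigD1 i) //= eqxx mul1r (negbTE (PN _ _)) mul0r addr0 big1 ?addr0
  // => j ji.
by rewrite (inj_eq P_inj) eq_sym (negbTE ji) (negbTE (PN _ _)) !mul0r addr0.
Qed.

Let FN y i : F y (N i) = Num.max 0 (- sphere_coord y i).
Proof.
rewrite /F (bigD1 i) //= eqxx mul1r eq_sym (negbTE (PN _ _)) mul0r add0r big1
  ?addr0 // => j ji.
by rewrite (inj_eq N_inj) (eq_sym i) (negbTE ji) eq_sym (negbTE (PN _ _)) !mul0r addr0.
Qed.

Let F_out y v : v \notin T -> F y v = 0.
Proof.
move=> vT; rewrite /F big1 // => i _.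
have /negbTE -> : v != P i by apply: contraNneq vT => ->.
have /negbTE -> : v != N i by apply: contraNneq vT => ->.
by rewrite !mul0r addr0.
Qed.

Let F_ge0 y v : 0 <= F y v.
Proof. by apply: sumr_ge0 => i _; rewrite addr_ge0 // mulr_ge0 // le_max lexx. Qed.

Let F_continuous v : continuous (F ^~ v).
Proof.
apply: sum_continuous => i; apply: add_fun_continuous; apply: mul_fun_continuous;
  try exact: cst_fun_continuous.
- by apply: max_fun_continuous; [exact: cst_fun_continuous|exact:
    sphere_coord_continuous].
- apply: max_fun_continuous; first exact: cst_fun_continuous.
  apply: (@comp_continuous _ _ _ (fun y : sphere R n => sphere_coord y i) -%R).
    exact: sphere_coord_continuous.
  exact: opp_continuous.
Qed.

Let F_gt0 y : 0 < \sum_v F y v.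
Proof.
rewrite lt_neqAle sumr_ge0 ?andbT //; apply/negP => /eqP /esym /eqP.
rewrite psumr_eq0 // => /allP Fy.
have Fy0 v : F y v = 0 by apply/eqP; have := Fy v; rewrite mem_index_enum; exact.
have := sphere_coord_sum y; rewrite big1 => [/esym/eqP|i _]; first by rewrite oner_eq0.
suff -> : sphere_coord y i = 0 by rewrite expr0n.
have := Fy0 (P i); rewrite FP => /max_idPl yi.
have := Fy0 (N i); rewrite FN => /max_idPl; rewrite oppr_le0 => yi'.
by apply/eqP; rewrite eq_le yi.
Qed.

Let F_K y : supp (F y) \in K.
Proof.
rewrite KT; last first.
  by apply/fintype.subsetP => v; rewrite inE; apply: contra_neqT => /F_out ->.
apply/forallP => i; rewrite !inE FP FN; apply/negP => /andP[].
have /orP[yi|yi] := le_total 0 (sphere_coord y i).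
  by move=> _; rewrite (max_idPl _) ?oppr_le0 ?eqxx.
by rewrite (max_idPl yi) eqxx.
Qed.

Let x (t : realization R K) i := bary t (P i) - bary t (N i).
Let nsq t := \sum_i x t i ^+ 2.

Let x_continuous i : continuous (x ^~ i).
Proof. by apply: sub_fun_continuous; exact: bary_continuous. Qed.

Let nsq_continuous : continuous nsq.
Proof.
apply: sum_continuous => i.
rewrite (_ : (fun t => _) = (fun t => x t i * x t i)).
  by apply: mul_fun_continuous; exact: x_continuous.
by apply/funext => t; rewrite expr2.
Qed.

(** On the cross-polytope at most one of [P i] and [N i] carries weight, so the weights are the
    positive and negative parts of the differences [x t i]. The two maps only rescale these
    differences between total weight 1 and Euclidean norm 1, hence are mutually inverse. *)
Lemma cross_polytope_chart : inhabited (sphere_chart R cross_polytope).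
Proof.
have [inn [inn_c innE]] := normalized_map F_continuous F_ge0 F_gt0 F_K.
(* Where all differences vanish, which never happens on the cross-polytope, the value is
   arbitrary. *)
have /choice[out outE] : forall t, exists y : sphere R n,
    0 < nsq t -> forall i, sphere_coord y i = x t i / Num.sqrt (nsq t).
  move=> t; have [t0|t0] := ltP 0 (nsq t).
    by have [y yE] := sphere_of t0; exists y.
  by exists (sphere_default n).
have tPN t i : cross_polytope t -> bary t (P i) = 0 \/ bary t (N i) = 0.
  move=> tT; have := bary_supp t; rewrite KT; last first.
    apply/fintype.subsetP => v; rewrite inE; apply: contra_neqT; exact: tT.
  move=> /forallP /(_ i); rewrite !inE negb_and !negbK.
  by case/orP => /eqP; [left|right].
have nsq_gt0 t : cross_polytope t -> 0 < nsq t.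
  move=> tT; rewrite lt_neqAle sumr_ge0 ?andbT => [|i _]; last exact: sqr_ge0.
  apply/negP => /eqP /esym /eqP; rewrite psumr_eq0 => [/allP nt|i _];
    last exact: sqr_ge0.
  have xt i : bary t (P i) = bary t (N i).
    by apply/eqP; rewrite -subr_eq0 -sqrf_eq0; apply: nt; exact: mem_index_enum.
  have := bary_sum t; rewrite big1 => [/esym/eqP|v _]; first by rewrite oner_eq0.
  have [/TP[i [->|->]]|/tT//] := boolP (v \in T).
    by have [|] := tPN t i tT => // h; rewrite xt.
  by have [|] := tPN t i tT => // h; rewrite -xt.
apply: inhabits; apply: (@SphereChart _ _ _ n inn out) => //.
- by move=> y v vT; rewrite innE F_out // mul0r.
- move=> y; apply: sphere_coord_inj => i.
  set c := \sum_v F y v in innE *.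
  have c0 : 0 < c by exact: F_gt0.
  have xE j : x (inn y) j = sphere_coord y j / c.
    rewrite /x !innE -/c -mulrBl FP FN; congr (_ / _).
    have /orP[yi|yi] := le_total 0 (sphere_coord y j).
      by rewrite (max_idPr yi) (max_idPl _) ?subr0 // oppr_le0.
    by rewrite (max_idPl yi) (max_idPr _) ?sub0r ?opprK // oppr_ge0.
  have nE : nsq (inn y) = c^-1 ^+ 2.
    rewrite /nsq; under eq_bigr do rewrite xE exprMn.
    by rewrite -mulr_suml sphere_coord_sum mul1r.
  rewrite outE nE ?exprn_gt0 ?invr_gt0 // xE sqrtr_sqr ger0_norm ?invr_ge0 ?ltW //.
  by rewrite invrK divfK // gt_eqF.
- move=> t tT; apply: sphere_continuous_at => i.
  have tn := nsq_gt0 t tT.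
  have cx : {for t, continuous (fun z => x z i / Num.sqrt (nsq z))}.
    have xt : x z i @[z --> t] --> x t i by exact: x_continuous.
    have nt : Num.sqrt (nsq z) @[z --> t] --> Num.sqrt (nsq t).
      apply: (@continuous_comp _ _ _ nsq Num.sqrt); first exact: nsq_continuous.
      exact: sqrt_continuous.
    by apply: cvgM xt (cvgV _ nt); rewrite gt_eqF // sqrtr_gt0.
  (* The formula for [out] is available only where [nsq] is positive, an open condition. *)
  have near0 : \forall z \near t, 0 < nsq z.
    have nt : nsq z @[z --> t] --> nsq t by exact: nsq_continuous.
    have h := cvgr_gt (nsq t) nt 0 tn; exact: h.
  rewrite /prop_for /continuous_at outE //.
  apply: cvg_trans cx; apply: (@near_eq_cvg _ _ (nbhs t)).
  by near=> z; rewrite outE //; near: z; exact: near0.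
- move=> t tT; have tn := nsq_gt0 t tT; apply: bary_inj => v; rewrite innE.
  have s0 : 0 < Num.sqrt (nsq t) by rewrite sqrtr_gt0.
  have FE w : F (out t) w = bary t w / Num.sqrt (nsq t).
    have [/TP[i iw]|wT] := boolP (w \in T); last by rewrite F_out // tT // mul0r.
    case: iw => ->; rewrite ?FP ?FN outE //.
      have [h|h] := tPN t i tT; rewrite /x h ?subr0 ?sub0r ?mul0r.
        by apply/max_idPl; rewrite mulNr oppr_le0 divr_ge0 // ?bary_ge0 // ltW.
      by apply/max_idPr; rewrite divr_ge0 // ?bary_ge0 // ltW.
    have [h|h] := tPN t i tT; rewrite /x h ?subr0 ?sub0r ?mul0r.
      by rewrite mulNr opprK; apply/max_idPr; rewrite divr_ge0 // ?bary_ge0 // ltW.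
    by apply/max_idPl; rewrite oppr_le0 divr_ge0 // ?bary_ge0 // ltW.
  under [in X in _ / X]eq_bigr do rewrite FE.
  by rewrite FE -mulr_suml bary_sum mul1r invrK divfK // gt_eqF.
Unshelve. all: by end_near. Qed.

End cross_polytope.

Section matchings.
Context {R : realType} {V : finType}.

Lemma enumerate_set (M : {set V}) v : v \in M ->
  exists n (P : 'I_n.+1 -> V), injective P /\ M = P @: 'I_n.+1.
Proof.
move=> vM; have M0 : (0 < #|M|)%N by apply/card_gt0P; exists v.
exists #|M|.-1; have cM := prednK M0.
exists (fun i => enum_val (cast_ord cM i)); split.
  by move=> i j /enum_val_inj /cast_ord_inj.
apply/setP => w; apply/idP/imsetP => [wM|[i _ ->]]; last exact: enum_valP.
exists (cast_ord (esym cM) (enum_rank_in vM w)) => //.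
by rewrite cast_ordKV enum_rankK_in.
Qed.

Lemma matching_chart (K : {set {set V}}) (M : {set V}) (tau : V -> V) v :
  v \in M -> {in M &, injective tau} -> {in M &, forall x y, x != tau y} ->
  (forall A : {set V}, A \subset M :|: tau @: M ->
     reflect {in M, forall x, x \in A -> tau x \notin A} (A \in K)) ->
  inhabited (sphere_chart R (@subcomplex R V K (M :|: tau @: M))).
Proof.
move=> vM tau_inj tauM KM; have [n [P [P_inj ME]]] := enumerate_set vM.
have PM i : P i \in M by rewrite ME imset_f.
have TE : M :|: tau @: M = P @: 'I_n.+1 :|: (tau \o P) @: 'I_n.+1.
  by rewrite (imset_comp tau P) -ME.
rewrite TE; apply: cross_polytope_chart => //.
- by move=> i j /tau_inj /P_inj; apply.
- by move=> i j; exact: tauM.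
- move=> A; rewrite -TE => /KM AK; apply/AK/forallP => [AM i|AM x].
    by apply/negP => /andP[/(AM _ (PM i)) /negbTE ->].
  rewrite {1}ME => /imsetP[i _ ->] PA; have := AM i.
  by rewrite PA.
Qed.

End matchings.

(** * Spaces covered by spheres *)

Section wedge_of_spheres.
Context {R : realType} {X : topologicalType}.

Lemma charts_wedge_of_spheres r (D : 'I_r.+1 -> set X) (x0 : X) (H : X * R -> X) :
  (forall i, closed (D i)) -> (forall x, exists i, D i x) -> (forall i, D i x0) ->
  (forall i, inhabited (sphere_chart R (D i))) ->
  continuous H -> (forall x, H (x, 0) = x) -> (forall s, H (x0, s) = x0) ->
  (forall i x s, D i x -> D i (H (x, s))) ->
  (forall i j x, i != j -> D i x -> D j x -> H (x, 1) = x0) ->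
  equivalent_to_wedge_of_spheres R X.
Proof.
move=> cD Dcov Dx0 chD cH H0 Hx0 HD H1.
have c i : sphere_chart R (D i).
  have /cid[ch _] // : exists _ : sphere_chart R (D i), True.
  by have [ch] := chD i; exists ch.
exists r, (fun i => chart_dim (c i)), (fun i => chart_out (c i) x0).
apply: (@wedge_decomposition R _ X _ D x0 (fun i => @chart_in _ _ _ (c i))
  (fun i => @chart_out _ _ _ (c i)) H) => // i.
- exact: chart_in_continuous.
- exact: chart_in_D.
- exact: chart_inK.
- exact: chart_out_continuous.
- exact: chart_outK.
- exact: sphere_closed1.
Qed.

Lemma chart_wedge_of_spheres : inhabited (sphere_chart R [set: X]) ->
  equivalent_to_wedge_of_spheres R X.
Proof.
move=> [c]; have x0 : X := @chart_in _ _ _ c (sphere_default _).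
(* A sphere is a wedge with one summand ([r = 0]), and the constant homotopy serves. *)
apply: (@charts_wedge_of_spheres 0 (fun=> setT) x0 fst) => //.
- by move=> x; exists ord0.
- exact: fst_continuous.
- by move=> i j; rewrite !ord1.
Qed.

End wedge_of_spheres.

(** * Two spheres meeting in a cone *)

Section two_spheres.
Context {R : realType} {V : finType}.
Variables (S E : {set V}) (e : rel V) (a p q : V).
Hypotheses (es : symmetric e) (pS : p \in S) (epp : ~~ e p p)
  (aE : a \notin E) (pE : p \notin E) (qE : q \notin E)
  (pa : p != a) (qa : q != a) (pq : p != q)
  (ep : forall z, z \in S -> e p z -> (z == q) || (z == a))
  (ea : forall z, z \in S -> z \notin E -> z != a -> e a z).

Local Notation X := (realization R (ind S e)).

Let mass (x : X) : R := \sum_(v in E) bary x v.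

Let room (x : X) (s : R) : R := Num.max 0 (s * mass x - bary x q - bary x a).

(** The vertices [q] and [a] are the only possible neighbours of [p], so weight may flow to [p] only
    once both are empty. Hence [s * mass] is first cut from each of them, and only its excess over
    their joint weight, the [room], is available for draining the vertices of [E] into [p]. Positive
    [room] forces [q] and [a] to be empty. The total is not preserved; normalization restores it. *)
Let F (z : X * R) (v : V) : R :=
  let x := z.1 in let s := clamp z.2 in
  if v \in E then bary x v - Num.min (bary x v) (room x s)
  else if v == p then bary x p + \sum_(w in E) Num.min (bary x w) (room x s)
  else if (v == q) || (v == a) then Num.max 0 (bary x v - s * mass x)
  else bary x v.

Let room_ge0 x s : 0 <= room x s.
Proof. by rewrite /room le_max lexx. Qed.

Let mass_ge0 x : 0 <= mass x.
Proof. by apply: sumr_ge0 => v _; exact: bary_ge0. Qed.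

Let min_ge0 x s v : 0 <= Num.min (bary x v) (room x s).
Proof. by rewrite le_min bary_ge0 room_ge0. Qed.

Let F_ge0 z v : 0 <= F z v.
Proof.
rewrite /F; case: ifP => _; first by rewrite subr_ge0 ge_min lexx.
case: ifP => _; first by rewrite addr_ge0 ?bary_ge0 // sumr_ge0.
by case: ifP => _; [rewrite le_max lexx|exact: bary_ge0].
Qed.

Let F_id x s : clamp s * mass x = 0 -> F (x, s) = bary x.
Proof.
move=> sm0; have r0 : room x (clamp s) = 0.
  apply/max_idPl; rewrite sm0 sub0r -opprD oppr_le0 addr_ge0 ?bary_ge0 //.
have m0 v : Num.min (bary x v) (room x (clamp s)) = 0.
  by rewrite r0; apply/min_idPr; exact: bary_ge0.
apply/funext => v; rewrite /F /=; case: ifP => _; first by rewrite m0 subr0.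
case: ifP => [/eqP ->|_]; first by rewrite big1 ?addr0.
by case: ifP => // _; rewrite sm0 subr0; apply/max_idPr; exact: bary_ge0.
Qed.

(** If all weights vanished, nothing would have reached [p], so nothing would have left [E] and
    [mass] would be 0; but then [F] changes nothing. *)
Let F_gt0 z : 0 < \sum_v F z v.
Proof.
rewrite lt_neqAle sumr_ge0 ?andbT //; apply/negP => /eqP /esym /eqP.
rewrite psumr_eq0 // => /allP Fz.
have F0 v : F z v = 0 by apply/eqP; have := Fz v; rewrite mem_index_enum; exact.
have Fp := F0 p; move: Fp; rewrite /F (negbTE pE) eqxx => /eqP.
rewrite paddr_eq0 ?bary_ge0 ?sumr_ge0 // psumr_eq0 // => /andP[_ /allP minE].
have m0 : mass z.1 = 0.
  rewrite /mass big1 // => v vE; have := F0 v; rewrite /F vE.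
  have := minE v; rewrite mem_index_enum vE /= => /(_ isT) /eqP ->.
  by rewrite subr0.
have := F_id (x := z.1) (s := z.2); rewrite m0 mulr0 => /(_ erefl).
rewrite -surjective_pairing => FE; have := bary_sum z.1; rewrite -FE.
by rewrite big1 // => /esym/eqP; rewrite oner_eq0.
Qed.

Let F_K z : supp (F z) \in ind S e.
Proof.
have /indP[zS ze] := bary_supp z.1.
have [r0|r0] := eqVneq (room z.1 (clamp z.2)) 0.
  apply: (ind_down_closed (bary_supp z.1)); apply/fintype.subsetP => v.
  rewrite !inE; apply: contra_neq => zv.
  rewrite /F zv r0; case: ifP => _; first by rewrite minxx subr0.
  case: ifP => [/eqP vp|_].
    rewrite -vp zv add0r big1 // => w _; apply/min_idPr; exact: bary_ge0.
  case: ifP => // _; rewrite sub0r; apply/max_idPl.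
  by rewrite oppr_le0 mulr_ge0 ?clamp_ge0.
have {}r0 : bary z.1 q + bary z.1 a < clamp z.2 * mass z.1.
  rewrite ltNge; apply/negP => le; move/negP: r0; apply; apply/eqP/max_idPl.
  by rewrite -addrA -opprD subr_le0.
have Fqa v : (v == q) || (v == a) -> F z v = 0.
  move=> vqa; rewrite /F.
  have -> : (v \in E) = false by case/orP: vqa => /eqP ->; exact/negbTE.
  have -> : (v == p) = false.
    by case/orP: vqa => /eqP ->; rewrite eq_sym; exact/negbTE.
  rewrite vqa; apply/max_idPl; rewrite subr_le0; apply: le_trans (ltW r0).
  by case/orP: vqa => /eqP ->; rewrite ?lerDl ?lerDr bary_ge0.
have Fsub v : v \in supp (F z) -> v = p \/ [/\ v \in supp (bary z.1), v != q & v != a].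
  rewrite inE => Fv; have [->|vp] := eqVneq v p; [by left|right].
  have : ~~ ((v == q) || (v == a)) by apply: contraNN Fv => /Fqa ->.
  rewrite negb_or => /andP[vq va]; split=> //; rewrite inE.
  move: Fv; rewrite /F (negbTE vp) (negbTE vq) (negbTE va) /=.
  case: ifP => // _; apply: contra_neq => ->.
  by rewrite (min_idPl _) ?subrr // room_ge0.
apply/indP; split=> [v /Fsub[->//|[/zS]//]|v w /Fsub vF /Fsub wF].
have pn u : u \in supp (bary z.1) -> u != q -> u != a -> ~~ e p u.
  move=> uz uq ua; apply/negP => /(ep (zS _ uz)).
  by rewrite (negbTE uq) (negbTE ua).
case: vF wF => [->|[vz vq va]] [->|[wz wq wa]] //.
- exact: pn.
- by rewrite es; exact: pn.
- exact: ze.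
Qed.

Let F_continuous v : continuous (F ^~ v).
Proof.
have cb w : continuous (fun z : X * R => bary z.1 w).
  exact: (comp_continuous (@fst_continuous X R) (@bary_continuous R V _ w)).
have cs : continuous (fun z : X * R => clamp z.2).
  exact: (comp_continuous (@snd_continuous X R) clamp_continuous).
have csm : continuous (fun z : X * R => clamp z.2 * mass z.1).
  by apply: mul_fun_continuous cs _; exact: sum_continuous.
have cr : continuous (fun z : X * R => room z.1 (clamp z.2)).
  apply: max_fun_continuous; first exact: cst_fun_continuous.
  by apply: sub_fun_continuous => //; exact: sub_fun_continuous.
have cm w : continuous (fun z : X * R => Num.min (bary z.1 w) (room z.1 (clamp z.2))).
  exact: min_fun_continuous.
rewrite /F /=; case: (v \in E); first exact: sub_fun_continuous.
case: (v == p); first by apply: add_fun_continuous => //; exact: sum_continuous.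
case: ((v == q) || (v == a)) => //; apply: max_fun_continuous;
  first exact: cst_fun_continuous.
exact: sub_fun_continuous.
Qed.

(* The two full subcomplexes on [S :\ a] and on [E] with [a] and [p] cover the
   realization and meet in the cone with apex [p] over the complex on [E].  The
   deformation contracts this cone to [p], after shrinking a neighbourhood of
   it (given by [q] and [a], which are not joined to [p]) onto it. *)
Lemma two_spheres_wedge :
  inhabited (sphere_chart R (@subcomplex R V (ind S e) (S :\ a))) ->
  inhabited (sphere_chart R (@subcomplex R V (ind S e) (a |: (p |: E)))) ->
  equivalent_to_wedge_of_spheres R X.
Proof.
move=> ch0 ch1.
have [H [cH HE]] := normalized_map F_continuous F_ge0 F_gt0 F_K.
have [x0 x0E] := vertex_point (R := R) pS epp.
have H_id x s : clamp s * mass x = 0 -> H (x, s) = x.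
  by move=> /F_id FE; apply: bary_inj => v; rewrite HE FE bary_sum divr1.
pose T (i : 'I_2) : {set V} := if i == ord0 then S :\ a else a |: (p |: E).
have H_T i x s : subcomplex (T i) x -> subcomplex (T i) (H (x, s)).
  move=> xT v vT; rewrite HE; suff -> : F (x, s) v = 0 by rewrite mul0r.
  have xv := xT v vT; rewrite /F xv.
  case: ifP => vE; first by rewrite (min_idPl _) ?subrr // room_ge0.
  case: ifP => [/eqP vp|_].
    move: vT; rewrite vp /T; case: ifP => _; rewrite !inE ?pS ?pa ?eqxx ?orbT //.
  case: ifP => // _; rewrite sub0r; apply/max_idPl.
  by rewrite oppr_le0 mulr_ge0 ?clamp_ge0 ?mass_ge0.
apply: (@charts_wedge_of_spheres R X 1 (fun i => subcomplex (T i)) x0 H) => //.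
- by move=> i; exact: subcomplex_closed.
- move=> x; have /indP[xS xe] := bary_supp x.
  have [xa|xa] := eqVneq (bary x a) 0.
    exists ord0 => v; rewrite /T eqxx !inE negb_and negbK => /orP[/eqP->//|vS].
    by apply/eqP; apply: contraNT vS => xv; apply: xS; rewrite inE.
  (* A simplex containing [a] has all its other vertices in [E], since [a] is joined to the rest. *)
  exists ord_max => v; rewrite /T /= !inE !negb_or => /and3P[va _ vE].
  apply/eqP; apply/negPn/negP => xv.
  have vx : v \in supp (bary x) by rewrite inE.
  by have := xe a v; rewrite ea ?inE ?xS // => /(_ xa xv).
- move=> i v vT; rewrite x0E; case: eqP => // vp; move: vT; rewrite vp /T.
  by case: ifP => _; rewrite !inE ?pS ?pa ?eqxx ?orbT.
- by case=> [[|[|//]] ?]; rewrite /T.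
- by move=> x; apply: H_id; rewrite clamp0 mul0r.
- move=> s; apply: H_id; rewrite /mass big1 ?mulr0 // => v vE; rewrite x0E.
  by case: eqP => // vp; move: pE; rewrite -vp vE.
- move=> i j x ij xi xj.
  have {i j ij xi xj} [x_0 x_1] : subcomplex (S :\ a) x /\ subcomplex (a |: (p |: E)) x.
    by move: i j ij xi xj => [[|[|//]] ?] [[|[|//]] ?].
  have xa : bary x a = 0 by apply: x_0; rewrite !inE eqxx.
  have xq : bary x q = 0.
    by apply: x_1; rewrite !inE !negb_or qa qE eq_sym pq.
  (* On the overlap [q] and [a] carry no weight, so at time 1 the room is the whole mass. It bounds
     each weight on [E], and all of them are drained into [p]. *)
  have rm : room x (clamp 1) = mass x.
    by rewrite /room clamp1 mul1r xa xq !subr0; apply/max_idPr.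
  have F0 v : v != p -> F (x, 1) v = 0.
    move=> vp; rewrite /F /= rm (negbTE vp); case: ifP => vE.
      rewrite (min_idPl _) ?subrr // /mass (bigD1 v) //= lerDl.
      by apply: sumr_ge0 => w _; exact: bary_ge0.
    case: ifP => [/orP[]/eqP->|/negbT]; rewrite ?xa ?xq ?sub0r ?negb_or.
    + by apply/max_idPl; rewrite oppr_le0 mulr_ge0 ?clamp_ge0.
    + by apply/max_idPl; rewrite oppr_le0 mulr_ge0 ?clamp_ge0.
    + by move=> /andP[vq va]; apply: x_1; rewrite !inE !negb_or va vp vE.
  apply: bary_inj => v; rewrite HE x0E.
  have FE : \sum_w F (x, 1) w = F (x, 1) p.
    by rewrite (bigD1 p) //= big1 ?addr0.
  have [->|vp] := eqVneq v p; last by rewrite F0 // mul0r.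
  by rewrite FE divff // -FE gt_eqF.
Qed.

End two_spheres.

(** * Wedges of cycles *)

(** On [T] the graph is a perfect matching, and a set is independent when it contains no matched
    pair: these are the faces of a cross-polytope with the matched pairs as opposite vertices. *)
Lemma matching_graph_chart (R : realType) (V : finType) (S T M : {set V})
    (e : rel V) (tau : V -> V) v : T \subset S -> v \in M ->
  {in M &, injective tau} -> {in M &, forall x y, x != tau y} ->
  {in M, forall x, x \in T /\ tau x \in T} ->
  {in T, forall x, x \in M \/ exists2 y, y \in M & x = tau y} ->
  {in T &, forall x y, e x y =
    ((x \in M) && (y == tau x)) || ((y \in M) && (x == tau y))} ->
  inhabited (sphere_chart R (@subcomplex R V (ind S e) T)).
Proof.
move=> /fintype.subsetP TS vM tau_inj tauM MT TM eE.
have TE : T = M :|: tau @: M.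
  apply/setP => x; apply/idP/finset.setUP => [/TM[xM|[y yM ->]]|].
  - by left.
  - by right; rewrite imset_f.
  - by move=> [/MT[]//|/imsetP[y /MT[_ yT] ->]].
rewrite TE; apply: (matching_chart vM tau_inj tauM) => A;
  rewrite -TE => /fintype.subsetP AT.
apply: (iffP (indP _ _ _)) => [[_ Ae] x xM xA|Ae].
  apply/negP => tA; have := Ae _ _ xA tA.
  by rewrite eE ?AT // xM eqxx.
split=> [x /AT/TS//|x y xA yA]; rewrite eE ?AT //.
apply/negP => /orP[] /andP[zM /eqP zE].
  by have := Ae _ zM xA; rewrite -zE yA.
by have := Ae _ zM yA; rewrite -zE xA.
Qed.

Local Open Scope nat_scope.

Ltac ord_lia := repeat match goal with
  | |- context [nat_of_ord ?u] => move: (nat_of_ord u) => ? end; lia.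

(** * Shortening the cycles *)

Section reduced_wedges.
Variables (k : nat) (m : 'I_k -> nat).
Implicit Types (J : 'I_k -> nat) (i l : 'I_k) (u v : nat).

(** One range of positions for all cycles avoids dependent types; [alive] discards the positions
    that a given cycle lacks. *)
Local Notation pos := 'I_(\max_i m i).+1.

(* [None] is the common vertex and [Some (i, u)] is the vertex at distance [u]
   from it along the [i]-th cycle. *)
Definition vtx : finType := option ('I_k * pos).

(** Out of range, [inord] falls back to position 0, hence the bounds carried along below. *)
Definition vx i u : vtx := Some (i, inord u).

Lemma vx_bound i u : u < m i -> u < (\max_l m l).+1.
Proof. by move=> um; rewrite ltnS ltnW // (leq_trans um) // leq_bigmax. Qed.

Lemma vtx_eq i (u : pos) l v : v < m l ->
  (Some (i, u) == vx l v :> vtx) = (i == l) && (u == v :> nat).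
Proof.
move=> vm; rewrite /vx (inj_eq (@Some_inj _)) xpair_eqE; congr (_ && _).
by rewrite -val_eqE /= inordK // (vx_bound vm).
Qed.

Lemma vtx_eqN l v : (None == vx l v :> vtx) = false.
Proof. by []. Qed.

Lemma Some_eqN l (v : pos) : (Some (l, v) == None :> vtx) = false.
Proof. by []. Qed.

(* The state [J] records that [J i] times three edges of the [i]-th cycle have
   been contracted: the vertices [3 l + 1] are gone, [3 l + 2] and [3 l + 3] are
   joined only to each other ([l < J i]), and the rest of the cycle has been
   closed up to a cycle of length [m i - 3 * J i]. *)
Definition alive J (x : vtx) : bool :=
  if x is Some (i, u) then (0 < u < m i) && ~~ ((u <= 3 * J i) && (u %% 3 == 1))
  else true.

(** The two ends of what remains of the cycle. They coincide when [m i = 3 * J i + 2], and the cycle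
    is then a pendant edge. *)
Definition root_adj J i u : bool := (u == (3 * J i).+1) || (u == (m i).-1).

Definition step_adj J i u v : bool :=
  (v == u.+1) && ((3 * J i < u) || (u %% 3 == 2)).

Definition wadj J : rel vtx := fun x y => match x, y with
  | None, None => false
  | None, Some (i, u) | Some (i, u), None => root_adj J i u
  | Some (i, u), Some (l, v) => (i == l) && (step_adj J i u v || step_adj J i v u)
  end.

Definition live J : {set vtx} := finset (alive J).

Lemma wadj_sym J : symmetric (wadj J).
Proof.
move=> [[i u]|] [[l v]|] //=; rewrite eq_sym; have [->|//] := eqVneq l i.
by rewrite orbC.
Qed.

Lemma wadj_irr J : irreflexive (wadj J).
Proof. by move=> [[i u]|] //=; rewrite /step_adj; lia. Qed.

Context {R : realType}.

Local Notation XJ J := (realization R (ind (live J) (wadj J))).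

(** The contracted path runs from the common vertex through the next four positions. If the bound is
    an equality, its last vertex is already joined to the common vertex, so adding the edge changes
    nothing and a pendant edge results. *)
Lemma contract_step J J' i : 3 * J i + 5 <= m i -> J' i = (J i).+1 ->
  (forall l, l != i -> J' l = J l) -> homotopy_equivalent R (XJ J) (XJ J').
Proof.
move=> mi J'i J'l.
have b1 : (3 * J i).+1 < m i by lia.
have b2 : (3 * J i).+2 < m i by lia.
have b3 : (3 * J i).+3 < m i by lia.
have b4 : (3 * J i).+4 < m i by lia.
have vB u : u < m i -> u < (\max_l m l).+1 by exact: vx_bound.
have -> : live J' = live J :\ vx i (3 * J i).+1.
  apply/setP => -[[l u]|]; rewrite !inE //= vtx_eq //.
  have [->|li] := eqVneq l i; last by rewrite J'l.
  by rewrite J'i; ord_lia.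
apply: (@path_contraction R vtx (live J) (wadj J) (wadj J') None
  (vx i (3 * J i).+1) (vx i (3 * J i).+2) (vx i (3 * J i).+3) (vx i (3 * J i).+4)).
- exact: wadj_sym.
- exact: wadj_sym.
- exact: wadj_irr.
- by rewrite /= !inE !vtx_eq // !inordK ?vB //; ord_lia.
- move=> z; rewrite !inE => /or3P[/eqP->//|/eqP->|/or3P[]/eqP->];
    rewrite /= ?inordK ?vB //; ord_lia.
- move=> [[l u]|]; rewrite inE /= ?vtx_eqN ?vtx_eq // inordK ?vB // /root_adj
    /step_adj ?eqxx //.
  by rewrite [i == l]eq_sym; have [->|//] := eqVneq l i; ord_lia.
- move=> [[l u]|]; rewrite inE /= ?vtx_eqN ?vtx_eq // inordK ?vB // /root_adj
    /step_adj ?eqxx //; last ord_lia.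
  by rewrite [i == l]eq_sym; have [->|//] := eqVneq l i; ord_lia.
- move=> [[l u]|]; rewrite inE /= ?vtx_eqN ?vtx_eq // inordK ?vB // /root_adj
    /step_adj ?eqxx //; last ord_lia.
  by rewrite [i == l]eq_sym; have [->|//] := eqVneq l i; ord_lia.
- move=> [[l u]|]; rewrite !inE /= ?vtx_eqN ?vtx_eq // inordK ?vB // /root_adj
    /step_adj ?eqxx //; last ord_lia.
  by rewrite [i == l]eq_sym; have [->|//] := eqVneq l i; ord_lia.
- by rewrite /= /root_adj J'i inordK ?vB //; ord_lia.
- move=> [[l u]|] [[l' u']|]; rewrite !inE /= ?vtx_eqN ?vtx_eq ?eqxx //=
    /root_adj /step_adj.
  + have [->|li] := eqVneq l i; last by move=> *; rewrite J'l.
    have [<-|//] := eqVneq i l'; rewrite J'i; ord_lia.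
  + by have [->|li] := eqVneq l i; [rewrite J'i; ord_lia|move=> *; rewrite J'l].
  + by have [->|li] := eqVneq l' i; [rewrite J'i; ord_lia|move=> *; rewrite J'l].
Qed.

Lemma contract_cycles J : (forall i, 3 * J i + 2 <= m i) ->
  homotopy_equivalent R (XJ (fun=> 0)) (XJ J).
Proof.
elim: {J}(\sum_i J i) {-2}J (erefl (\sum_i J i)) => [|n IHn] J Jn Jm.
  suff -> : J = fun=> 0.
    exists idfun, idfun; split; try (by move=> x; exact: cvg_id);
      by apply: homotopic_refl => x; exact: cvg_id.
  apply/funext => i; apply/eqP; rewrite -leqn0 -Jn; by rewrite (bigD1 i) //= leq_addr.
have [i Ji] : exists i, 0 < J i.
  apply/existsP; apply: contraPT Jn => /existsPn Jn.
  by rewrite big1 // => i _; apply/eqP; rewrite -leqn0 leqNgt.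
pose J' l := if l == i then (J i).-1 else J l.
apply: (@homotopy_equivalent_trans _ (XJ J')).
  apply: IHn => [|l]; last first.
    by rewrite /J'; case: eqP => [->|_]; [have := Jm i; lia|exact: Jm].
  apply/eqP; rewrite -eqSS -Jn [X in _ == X](bigD1 i) //= (bigD1 i) //= /J' eqxx.
  rewrite -[X in _ == X + _](prednK Ji) addSn eqSS; apply/eqP; congr (_ + _).
  by apply: eq_bigr => l /negbTE ->.
apply: (@contract_step J' J i); rewrite /J' ?eqxx.
- by have := Jm i; lia.
- by rewrite prednK.
- by move=> l /negbTE ->.
Qed.

Lemma alive_vx J i u : u < m i ->
  alive J (vx i u) = (0 < u < m i) && ~~ ((u <= 3 * J i) && (u %% 3 == 1)).
Proof. by move=> um; rewrite /alive /= inordK // (vx_bound um). Qed.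

(** Matched vertices are consecutive along a cycle, so this gives the partner of the first vertex of
    a pair. *)
Definition succv (x : vtx) : vtx := if x is Some (i, u) then vx i u.+1 else None.

Lemma succv_inj i l (u v : pos) : u.+1 < m i -> v.+1 < m l ->
  succv (Some (i, u)) = succv (Some (l, v)) -> Some (i, u) = Some (l, v).
Proof.
move=> um vm [<-] /(congr1 val) /=.
by rewrite !inordK ?(vx_bound um) ?(vx_bound vm) // => -[] /val_inj ->.
Qed.

(** * Graphs whose remaining cycles have length 2, 3 or 4 *)

Section final_graphs.
Variables (J : 'I_k -> nat).
Hypothesis J_le : forall i, 3 * J i + 2 <= m i <= 3 * J i + 4.

Definition paired : {set vtx} := finset (fun x : vtx =>
  if x is Some (i, u) then alive J x && (u <= 3 * J i) else false).

(** Position [3 * J i + 3] is live only in a square, as the second neighbour of the common vertex;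
    it will fold onto the first. *)
Definition unrooted : {set vtx} := finset (fun x : vtx =>
  if x is Some (i, u) then alive J x && (u != 3 * J i + 3 :> nat) else false).

(** Besides its split-off edges, each cycle contributes the edge between positions [3 * J i + 1] and
    [3 * J i + 2]. The larger set [S] is for triangles, where the common vertex is still present. *)
Lemma unrooted_chart (S : {set vtx}) i0 : unrooted \subset S ->
  (forall i, 3 * J i + 3 <= m i) ->
  inhabited (sphere_chart R (@subcomplex R _ (ind S (wadj J)) unrooted)).
Proof.
move=> TS Jm.
(* The first vertices of the matched pairs. *)
pose M : {set vtx} := finset (fun x : vtx => if x is Some (i, u) then
  [&& 0 < u, u < m i & (u <= 3 * J i) && (u %% 3 == 2) || (u == (3 * J i).+1 :>
    nat)] else false).
have MP i (u : pos) : Some (i, u) \in M -> u.+1 < m i.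
  by rewrite inE; have := Jm i; ord_lia.
apply: (@matching_graph_chart R _ S unrooted M (wadj J) succv (vx i0 (3 * J
  i0).+1)) => //.
- have m0 := Jm i0; rewrite inE /= inordK ?(@vx_bound i0) //; lia.
- move=> [[i u]|] [[l v]|] xM yM; try by move: xM yM; rewrite !inE.
  by apply: succv_inj; exact: MP.
- move=> [[i u]|] [[l v]|] xM yM; try by move: xM yM; rewrite !inE.
  rewrite /= vtx_eq ?MP //; have [il|//] /= := eqVneq i l.
  by move: xM yM; rewrite -il !inE; ord_lia.
- move=> [[i u]|] xM; last by move: xM; rewrite inE.
  have um := MP _ _ xM; move: xM; rewrite !inE /= inordK ?(vx_bound um) //.
  by have := Jm i; have := J_le i; ord_lia.
- move=> [[i u]|] xT; last by move: xT; rewrite inE.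
  have [|xM] := boolP (Some (i, u) \in M); [by left|right].
  have [m1 m2] := (Jm i, J_le i).
  have um : u < m i by move: xT; rewrite inE /=; ord_lia.
  have u0 : 0 < u by move: xT; rewrite inE /=; ord_lia.
  have um1 : u.-1 < m i by lia.
  exists (vx i u.-1); rewrite ?inE /= inordK ?(vx_bound um1) //.
    by move: xT xM; rewrite !inE /=; ord_lia.
  by apply/eqP; rewrite prednK // vtx_eq // !eqxx.
- move=> [[i u]|] [[l v]|] xT yT; try by move: xT yT; rewrite !inE.
  have [m1 m2] := (Jm i, J_le i).
  have eqS i' (u' : pos) l' (v' : pos) :
    (Some (i', u') \in M) && (Some (l', v') == succv (Some (i', u'))) =
    [&& Some (i', u') \in M, l' == i' & v' == u'.+1 :> nat].
    by case: (boolP (Some (i', u') \in M)) => //= /MP um; rewrite vtx_eq.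
  rewrite !eqS /=; have [il|il] := eqVneq i l; last first.
    by rewrite /= !andbF.
  move: xT yT; rewrite -il !inE /step_adj /=; ord_lia.
Qed.

Definition spike i0 : vtx := vx i0 (3 * J i0).+1.

Definition rooted i0 : {set vtx} := None |: (spike i0 |: paired).

(** The common vertex is matched with the spike, and every other edge is split off. This is the
    whole graph after folding along a pendant edge, and the second sphere in the case of
    triangles. *)
Lemma rooted_chart (S : {set vtx}) i0 : rooted i0 \subset S ->
  m i0 <= 3 * J i0 + 3 ->
  inhabited (sphere_chart R (@subcomplex R _ (ind S (wadj J)) (rooted i0))).
Proof.
move=> TS mi0; have J0 := J_le i0.
have b0 : (3 * J i0).+1 < m i0 by lia.
pose M : {set vtx} := spike i0 |: finset (fun x : vtx => if x is Some (i, u) then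
  [&& 0 < u, u < m i & (u <= 3 * J i) && (u %% 3 == 2)] else false).
pose tau x := if x == spike i0 then None else succv x.
have MP i (u : pos) : (Some (i, u) \in M) = (Some (i, u) == spike i0) ||
    [&& 0 < u, u < m i & (u <= 3 * J i) && (u %% 3 == 2)] by rewrite !inE.
have MN : None \notin M by rewrite !inE.
have ME i (u : pos) : Some (i, u) \in M -> Some (i, u) != spike i0 -> u.+1 < m i.
  rewrite MP => /orP[->//|uM _]; have := J_le i; move: uM; ord_lia.
have pE i (u : pos) : (Some (i, u) \in rooted i0) = (Some (i, u) == spike i0) ||
    alive J (Some (i, u)) && (u <= 3 * J i) by rewrite !inE.
apply: (@matching_graph_chart R _ S (rooted i0) M (wadj J) tau (spike i0)) => //.
- by rewrite !inE eqxx.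
- move=> [[i u]|] [[l v]|] xM yM; try by move: MN; rewrite ?xM ?yM.
  rewrite /tau; have [->|xs] := eqVneq; have [->|ys] := eqVneq => // xy.
  by apply: succv_inj xy; exact: ME.
- move=> [[i u]|] [[l v]|] xM yM; try by move: MN; rewrite ?xM ?yM.
  rewrite /tau; case: ifPn => // ys.
  rewrite /= vtx_eq ?ME //; have [il|//] /= := eqVneq i l.
  subst l; move: xM yM ys; rewrite !MP /spike !vtx_eq //;
    have [->|_] := eqVneq i i0; ord_lia.
- move=> [[i u]|] xM; last by move: MN; rewrite xM.
  rewrite /tau pE; have [xs|xs] := eqVneq (Some (i, u)) (spike i0);
    first by rewrite !inE.
  have um := ME _ _ xM xs; rewrite pE /spike !vtx_eq // /= inordK ?(vx_bound um) //.
  move: xM; rewrite MP (negbTE xs) /= orbC; have := J_le i; ord_lia.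
- move=> [[i u]|] xT; last by right; exists (spike i0); rewrite ?inE ?eqxx // /tau eqxx.
  have [|xM] := boolP (Some (i, u) \in M); [by left|right].
  move: xT xM; rewrite pE MP negb_or => /orP[->//|xT] /andP[xs xM].
  have m2 := J_le i.
  have um : u < m i by move: xT; rewrite /=; ord_lia.
  have u0 : 0 < u by move: xT; rewrite /=; ord_lia.
  have um1 : u.-1 < m i by lia.
  have ns : vx i u.-1 != spike i0.
    rewrite /spike vtx_eq // inordK ?(vx_bound um1) //; have [ii|//] := eqVneq i i0.
    by rewrite -ii; move: xT; rewrite /=; ord_lia.
  exists (vx i u.-1).
    rewrite MP /= inordK ?(vx_bound um1) //; move: xT xM; rewrite /=; ord_lia.
  rewrite /tau (negbTE ns) /= inordK ?(vx_bound um1) //.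
  by apply/eqP; rewrite prednK // vtx_eq // !eqxx.
- have eqS x y : (x \in M) && (y == tau x) =
     ((x == spike i0) && (y == None)) ||
     (if x is Some (i, u) then if y is Some (l, v) then
       [&& (0 < u) && (u < m i), (u <= 3 * J i) && (u %% 3 == 2), l == i & v ==
         u.+1 :> nat]
      else false else false).
    rewrite /tau; have [->|xs] /= := eqVneq x (spike i0).
      rewrite !inE eqxx /=; case: y => [[l v]|] //=;
        rewrite Some_eqN inordK ?(vx_bound b0) //; ord_lia.
    case: x xs => [[i u]|] xs; last by rewrite (negbTE MN).
    rewrite MP (negbTE xs) /=; case: (boolP [&& _, _ & _]) => //= uM; last first.
      by case: y => [[l v]|] //; move: uM; ord_lia.
    have um : u.+1 < m i by have := J_le i; move: uM; ord_lia.
    case: y => [[l v]|] //=; rewrite vtx_eq //.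
    by move: uM; case: (l == i); ord_lia.
  move=> x y xT yT; rewrite !eqS.
  case: x y xT yT => [[i u]|] [[l v]|] xT yT //=; rewrite ?andbF ?andbT ?orbF /=.
  + rewrite eq_sym; have [il|il] := eqVneq l i; last by rewrite !andbF.
    move: xT yT; rewrite !pE il /spike !vtx_eq // /step_adj /=.
    by have := J_le i; have [->|_] := eqVneq i i0; ord_lia.
  + move: xT; rewrite pE /spike vtx_eq // /root_adj /=.
    by have := J_le i; have [->|_] := eqVneq i i0; ord_lia.
  + move: yT; rewrite pE /spike vtx_eq // /root_adj /=.
    by have := J_le l; have [->|_] := eqVneq l i0; ord_lia.
Qed.

Lemma subcomplex_full (T : {set vtx}) (e : rel vtx) :
  @subcomplex R _ (ind T e) T = setT.
Proof.
apply/seteqP; split=> // x _ v vT; have /indP[xT _] := bary_supp x.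
by apply/eqP; apply: contraNT vT => xv; apply: xT; rewrite inE.
Qed.

Lemma paired_live : paired \subset live J.
Proof.
by apply/fintype.subsetP => -[[i u]|]; rewrite !inE // => /andP[].
Qed.

Lemma unrooted_live : unrooted \subset live J.
Proof.
by apply/fintype.subsetP => -[[i u]|]; rewrite !inE // => /andP[].
Qed.

Lemma spike_live i : spike i \in live J.
Proof. by have h := J_le i; rewrite inE /spike alive_vx; lia. Qed.

Lemma rooted_live i : rooted i \subset live J.
Proof.
apply/fintype.subsetP => x; case/setU1P => [->|/setU1P[->|]]; first by rewrite inE.
  exact: spike_live.
exact: (fintype.subsetP paired_live).
Qed.

(** In a square the two neighbours of the vertex opposite the common one are also neighbours of the
    common vertex, which thus folds onto the opposite vertex. The two middle vertices of a square
    have the same neighbours, so one folds onto the other. *)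
Lemma square_fold i4 : m i4 = 3 * J i4 + 4 ->
  homotopy_equivalent R (XJ J) (realization R (ind unrooted (wadj J))).
Proof.
move=> m4.
have b4 : (3 * J i4).+2 < m i4 by lia.
have b1 i : (3 * J i).+1 < m i by have := J_le i; lia.
apply: (fold_equivalence (phi := fun x : vtx => if x is Some (i, u) then
  if u == 3 * J i + 3 :> nat then vx i (3 * J i).+1 else x else vx i4 (3 * J i4).+2)).
- exact: wadj_sym.
- exact: unrooted_live.
- move=> [[i u]|]; last first.
    by move=> _; rewrite inE -/(vx _ _) alive_vx // /= inordK ?(vx_bound b4) //; lia.
  rewrite inE => xS; case: ifPn => [_|u3]; last by rewrite inE xS.
  by have := b1 i; rewrite inE -/(vx _ _) alive_vx // /= inordK ?(vx_bound (b1
    i)) //; lia.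
- move=> [[i u]|] [[l v]|] //=; rewrite !inE /=.
  + case: ifPn => // /eqP u3 xS yS; rewrite /= inordK ?(vx_bound (b1 i)) //.
    have [li|//] := eqVneq l i; subst l.
    by move: xS yS u3; rewrite /step_adj; have := J_le i; ord_lia.
  + case: ifPn => // /eqP u3 xS _; rewrite /= inordK ?(vx_bound (b1 i)) //.
    by move: xS u3; rewrite /root_adj; have := J_le i; ord_lia.
  + move=> _ yS; rewrite inordK ?(vx_bound b4) //.
    have [li|//] := eqVneq l i4; subst l.
    by move: yS; rewrite /root_adj /step_adj; ord_lia.
  + by move=> _ _; rewrite /root_adj inordK ?(vx_bound b4) //; lia.
Qed.

(** The end of the pendant edge has the common vertex as its only neighbour, so all neighbours of
    the common vertex fold onto it. In triangles and pendant edges this removes every other vertex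
    except the common one and the split-off edges. *)
Lemma pendant_fold i2 : m i2 = 3 * J i2 + 2 -> (forall i, m i <= 3 * J i + 3) ->
  homotopy_equivalent R (XJ J) (realization R (ind (rooted i2) (wadj J))).
Proof.
move=> m2 m3.
have b1 : (3 * J i2).+1 < m i2 by lia.
apply: (fold_equivalence (phi := fun x => if wadj J None x then spike i2 else x)).
- exact: wadj_sym.
- exact: rooted_live.
- move=> x xS; case: ifPn => [_|nx]; first by rewrite !inE eqxx orbT.
  apply/setU1P; case: x xS nx => [[i u]|] xS nx; [right; apply/setU1P; right|by left].
  by move: xS nx; rewrite !inE /= /root_adj; have := J_le i; have := m3 i; ord_lia.
- move=> x y xS yS; case: ifPn => // nx ys.
  suff -> : y = None by [].
  case: y ys yS => [[l v]|] //=; rewrite inordK ?(vx_bound b1) // inE /=.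
  have [li|//] := eqVneq l i2; subst l.
  by rewrite /step_adj; ord_lia.
Qed.

Lemma final_homotopy_type i0 :
  contractible R (XJ J) \/ equivalent_to_wedge_of_spheres R (XJ J).
Proof.
have [i4 /eqP m4|no4] := pickP (fun i => m i == 3 * J i + 4).
  have XT := square_fold m4.
  have [i2 /eqP m2|no2] := pickP (fun i => m i == 3 * J i + 2).
    left; apply: homotopy_equivalent_contractible XT _.
    have b1 : (3 * J i2).+1 < m i2 by lia.
    (* The square has folded the common vertex away, which isolates the end of the pendant edge. *)
    apply: (@isolated_vertex_contractible R _ _ _ (spike i2)); first exact: wadj_sym.
      by rewrite inE /spike /= inordK ?(vx_bound b1) //; lia.
    move=> [[l v]|]; rewrite !inE //= inordK ?(vx_bound b1) // => vT.
    have [li|//] := eqVneq l i2; subst l.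
    by move: vT; rewrite /step_adj; ord_lia.
  right; apply: homotopy_equivalent_wedge_of_spheres XT _.
  apply: chart_wedge_of_spheres; rewrite -(subcomplex_full unrooted (wadj J)).
  apply: (unrooted_chart i4) => // i; have := no2 i; have := J_le i; lia.
have m3 i : m i <= 3 * J i + 3 by have := no4 i; have := J_le i; lia.
right; have [i2 /eqP m2|no2] := pickP (fun i => m i == 3 * J i + 2).
  apply: homotopy_equivalent_wedge_of_spheres (pendant_fold m2 m3) _.
  apply: chart_wedge_of_spheres; rewrite -(subcomplex_full (rooted i2) (wadj J)).
  exact: rooted_chart.
have {no2 no4} m3E i : m i = 3 * J i + 3.
  by have := no2 i; have := m3 i; have := J_le i; lia.
have b2 : (3 * J i0).+2 < m i0 by rewrite m3E; lia.
have b1 : (3 * J i0).+1 < m i0 by rewrite m3E; lia.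
have uE : unrooted = live J :\ None.
  apply/setP => -[[i u]|]; rewrite !inE //= m3E; ord_lia.
(* The apex [p] and its neighbour [q] are the two vertices of one arbitrary triangle other than the
   common vertex [a]; [E] consists of the split-off edges. *)
apply: (@two_spheres_wedge R _ (live J) paired (wadj J) None (spike i0)
  (vx i0 (3 * J i0).+2)).
- exact: wadj_sym.
- exact: spike_live.
- by rewrite wadj_irr.
- by rewrite inE.
- by rewrite inE /spike /= inordK ?(vx_bound b1) //; lia.
- by rewrite inE /spike /= inordK ?(vx_bound b2) //; lia.
- by [].
- by [].
- by rewrite vtx_eq // inordK ?(vx_bound b1) //; lia.
- move=> [[l v]|]; rewrite !inE //= ?eqxx ?orbT // inordK ?(vx_bound b1) // vtx_eq //.
  have [li|] := eqVneq i0 l; last by [].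
  by subst l; rewrite /step_adj m3E; ord_lia.
- move=> [[l v]|]; rewrite !inE //= => vS vE _; move: vS vE.
  by rewrite /root_adj m3E; ord_lia.
- rewrite -uE; apply: (unrooted_chart i0); first exact: unrooted_live.
  by move=> i; rewrite m3E.
- by apply: rooted_chart; [exact: rooted_live|rewrite m3E].
Qed.

End final_graphs.

(** With no contraction recorded, the two graphs differ by a rotation of each cycle that brings the
    chosen vertex [a i] to position 0. *)
Lemma cycle_wedge_reduced (a : forall i, 'I_(m i)) : (forall i, 3 <= m i) ->
  homotopy_equivalent R
    (realization R (independence_complex
      (graph_wedge_adj (fun i => @cycle_adj (m i)) a)))
    (XJ (fun=> 0)).
Proof.
move=> m3; rewrite independence_complexE.
(* The number of [ordS] steps from [a i] to [x]. *)
pose dist i (x : 'I_(m i)) := if a i <= x then x - a i else x + m i - a i.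
have dist_lt i (x : 'I_(m i)) : dist i x < m i.
  by rewrite /dist; have := ltn_ord x; have := ltn_ord (a i); case: ifP; lia.
have distP i (x : 'I_(m i)) : dist i x < m i /\
    (dist i x + a i = x \/ dist i x + a i = x + m i).
  by rewrite /dist; have := ltn_ord x; have := ltn_ord (a i); case: ifP; lia.
have dist_eq0 i (x : 'I_(m i)) : (dist i x == 0) = (x == a i).
  rewrite -val_eqE /dist /=; have := ltn_ord x; have := ltn_ord (a i).
  by case: ifP; lia.
have dist_ordS i (x y : 'I_(m i)) : (y == ordS x) =
    (dist i y == if (dist i x).+1 == m i then 0 else (dist i x).+1).
  have vS : val (ordS x) = if x.+1 == m i then 0 else x.+1.
    rewrite /=; have := ltn_ord x; rewrite leq_eqVlt => /orP[/eqP xm|xm].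
      by rewrite xm modnn eqxx.
    by rewrite modn_small // ltn_eqF.
  rewrite -val_eqE vS; have := distP _ x; have := distP _ y.
  have := ltn_ord x; have := ltn_ord y; have := ltn_ord (a i); have := m3 i.
  move: (dist i x) (dist i y) (nat_of_ord (a i)) => p q c /=.
  by do 2 case: ifP; lia.
pose undist i u : 'I_(m i) := insubd (a i) (if u + a i < m i then u + a i else
  u + a i - m i).
have undistE i u : u < m i -> val (undist i u) =
    if u + a i < m i then u + a i else u + a i - m i.
  move=> um; rewrite val_insubd; have ai := ltn_ord (a i).
  by case: (ltnP (u + a i) (m i)) => h; rewrite ifT //; lia.
have distK i (x : 'I_(m i)) : undist i (dist i x) = x.
  apply: val_inj; rewrite undistE //=; have := distP _ x; have := ltn_ord x.
  by move: (dist i x) => p; case: ifP; lia.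
have undistK i u : u < m i -> dist i (undist i u) = u.
  move=> um; have := distP _ (undist i u); have /= := undistE _ _ um.
  by have := ltn_ord (a i); case: ifP; lia.
pose phi (x : graph_wedge a) : vtx :=
  if x is Some p then vx (tag p) (dist (tag p) (val (tagged p))) else None.
pose psi (x : vtx) : graph_wedge a := if x is Some (i, u) then
  omap (fun y : {x : 'I_(m i) | x != a i} => Tagged (fun i => {x : 'I_(m i) | x
    != a i}) y)
    (insub (undist i u)) else None.
apply: (ind_isomorphic (phi := phi) (psi := psi)).
- move=> [[i [x xa]]|] _; rewrite inE //= inordK ?(@vx_bound i) //.
  by have := dist_eq0 _ x; rewrite (negbTE xa); have := dist_lt _ x; lia.
- by move=> w _; rewrite inE.
- move=> [[i [x xa]]|] _ //=; rewrite inordK ?(@vx_bound i) // distK.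
  by rewrite insubT.
- move=> [[i u]|]; rewrite inE //= => uS.
  have um : u < m i by move: uS; ord_lia.
  have ua : undist i u != a i by rewrite -dist_eq0 undistK //; move: uS; ord_lia.
  by rewrite insubT /= undistK //; apply/eqP; rewrite eq_sym vtx_eq // !eqxx.
- move=> [[i [x xa]]|] [[l [y ya]]|] _ _ //=.
  + rewrite (inordK (vx_bound (dist_lt _ x))) (inordK (vx_bound (dist_lt _ y))).
    have [il|//] /= := eqVneq i l; subst l; rewrite tagged_asE /=.
    rewrite /cycle_adj !dist_ordS /step_adj; move: xa ya; rewrite -!dist_eq0.
    have := dist_lt _ x; have := dist_lt _ y; move: (dist i x) (dist i y) => p q.
    by do 2 case: ifP; lia.
  + rewrite inordK ?(@vx_bound i) // /cycle_adj !dist_ordS /root_adj.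
    have /eqP -> : dist i (a i) == 0 by rewrite dist_eq0.
    move: xa; rewrite -dist_eq0; have := dist_lt _ x; have := m3 i.
    by do 2 case: ifP; lia.
  + rewrite inordK ?(@vx_bound l) // /cycle_adj !dist_ordS /root_adj.
    have /eqP -> : dist l (a l) == 0 by rewrite dist_eq0.
    move: ya; rewrite -dist_eq0; have := dist_lt _ y; have := m3 l.
    by do 2 case: ifP; lia.
Qed.

End reduced_wedges.

Theorem theorem3p6 (R : realType) (k : nat) (m : 'I_k -> nat)
    (a : forall i : 'I_k, 'I_(m i))
    (hk : (1 <= k)%N) (hm : forall i : 'I_k, (3 <= m i)%N) :
  let G := graph_wedge_adj (fun i : 'I_k => @cycle_adj (m i)) a in
  let X := realization R (independence_complex G) in
  contractible R X \/ equivalent_to_wedge_of_spheres R X.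
Proof.
(* The largest number of contractions that leaves length at least 2. *)
move=> G X; pose J i := (m i - 2) %/ 3.
have J_le i : 3 * J i + 2 <= m i <= 3 * J i + 4 by have := hm i; rewrite /J; lia.
have XJ : homotopy_equivalent R X (realization R (ind (live m J) (wadj J))).
  apply: homotopy_equivalent_trans (cycle_wedge_reduced a hm) _.
  by apply: contract_cycles => i; case/andP: (J_le i).
have [cX|wX] := final_homotopy_type (R := R) J_le (Ordinal hk).
  by left; apply: homotopy_equivalent_contractible cX.
by right; apply: homotopy_equivalent_wedge_of_spheres wX.
Qed.
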